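(* The function $\zeta(0,s)$ is analytic on $\mathbb{C}$ except at $s=2,1$, and has a pole at $s=2$ with residue $1$ and a pole at $s=1$ with residue $2\zeta(0)$. The function $\zeta(-1,s+1)$ is analytic except at $s=2,1$, and has a pole at $s=2$ with residue $1/2$ and a pole at $s=1$ with residue $\zeta(0)$. For an integer $n\ge2$, the function $\zeta(-n,s+n)$ is analytic except at $s=2,1,0,-2,-4,\dots,-2\lfloor n/2\rfloor+2$, and has poles: at $s=2$ with residue $\frac{1}{n+1}$; at $s=1$ with residue $\zeta(0)=-\frac12$; and at $s=-2k$ with residue $\binom{2k-n}{2k+1}\zeta(-2k-1)$, for $k=0,1,\dots,\lfloor n/2\rfloor-1$.
   Context: $\zeta(\cdot)$ of one variable is the Riemann zeta function. For an integer $n\ge 0$, $\zeta(-n,s+n)$ denotes the Euler–Zagier double zeta function $\zeta(s_1,s_2)=\sum_{1\le n_1<n_2} n_1^{-s_1}n_2^{-s_2}$ evaluated at $(s_1,s_2)=(-n,s+n)$; i.e. it is the meromorphic continuation to all $s\in\mathbb{C}$ of the series $\sum_{m,j\ge1} m^{n}(m+j)^{-s-n}$, which converges absolutely for $\Re(s)>2$. For an integer $a$ and non-negative integer $b$, $\binom{a}{b}=a(a-1)\cdots(a-b+1)/b!$. *)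

(* Defs.v *)
From Stdlib Require Import Reals ZArith Factorial.
From Coquelicot Require Export Coquelicot.

Open Scope R_scope.

(* x^s := exp(s * ln x) for a real x > 0 and complex s. *)
Definition cpow (x : R) (s : C) : C :=
  (exp (Re s * ln x) * cos (Im s * ln x), exp (Re s * ln x) * sin (Im s * ln x)).

(* complex differentiability of f at z (f holomorphic at z when this holds on a
   neighbourhood; we only use it on open sets) *)
Definition holo_at (f : C -> C) (z : C) : Prop :=
  @ex_derive C_AbsRing C_NormedModule f z.

Definition riemann_zeta (Z : C -> C) : Prop :=
  (forall s : C, s <> RtoC 1 -> holo_at Z s) /\
  (forall s : C, 1 < Re s ->
     @is_series C_AbsRing C_NormedModule
       (fun k : nat => cpow (INR (k + 1)) (Copp s)) (Z s)).

(* term m^n (m+j)^{-s-n}, with m = m'+1, j = j'+1 *)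
Definition dz_term (n : nat) (s : C) (m' j' : nat) : C :=
  Cmult (RtoC (INR (m' + 1) ^ n))
        (cpow (INR (m' + j' + 2)) (Copp (Cplus s (RtoC (INR n))))).

(* F agrees with the (absolutely convergent) series
   sum_{m,j>=1} m^n (m+j)^{-s-n} = zeta(-n, s+n) on Re s > 2
   (written as an iterated series). *)
Definition dz_rep (n : nat) (F : C -> C) : Prop :=
  forall s : C, 2 < Re s ->
    exists inner : nat -> C,
      (forall m : nat, @is_series C_AbsRing C_NormedModule (dz_term n s m) (inner m)) /\
      @is_series C_AbsRing C_NormedModule inner (F s).

Definition pole_res (F : C -> C) (a r : C) : Prop :=
  r <> RtoC 0 /\
  exists delta : R, 0 < delta /\
    exists g : C -> C,
      (forall z : C, Cmod (Cminus z a) < delta -> holo_at g z) /\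
      (forall z : C, 0 < Cmod (Cminus z a) < delta ->
         F z = Cplus (g z) (Cdiv r (Cminus z a))).

Fixpoint falling (a : Z) (b : nat) : R :=
  match b with
  | O => 1
  | S b' => falling a b' * (IZR a - INR b')
  end.
Definition gbinom (a : Z) (b : nat) : R := falling a b / INR (fact b).

(* Main.v *)
Require Import Defs.
From Stdlib Require Import Reals ZArith Lra Lia.
From Coquelicot Require Import Coquelicot.
Open Scope R_scope.

(** The inner sums are power sums, so by Faulhaber's formula zeta(-n, s+n) is the combination
    [sum_j n! b_j / (n+1-j)! * zeta (s-1+j)], with [b_j = B_j / j!], of shifted Riemann zeta
    functions, and its poles are the shifted poles of zeta whose coefficient does not vanish.
    What remains is the behaviour of an arbitrary holomorphic continuation of zeta near 1 and its
    values at 0, -1, -3, ...  These are read off the Euler-Maclaurin expansion, which agrees with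
    zeta on the real half line s > 1; the agreement spreads to a punctured disc around 1 by a
    uniqueness theorem.

    For uniqueness, put [s = 1 + exp w]: the difference becomes holomorphic in a half plane and
    zero on its real axis.  Goursat's theorem for this function times [exp (-n (w - w0)^2)], on a
    rectangle with one side on the real axis and [w0] in the middle of the opposite side,
    leaves only exponentially small contributions from the vertical sides, while the integral
    through [w0] concentrates at [w0]; hence the function vanishes at [w0]. *)

(** * Complex differentiability *)

(** [riemann_zeta] fixes neither a construction of the continuation nor the value at 1, and
    holomorphy is mere differentiability at each point, with no power series and no continuity of
    the derivative to start from. This is why Goursat's bisection comes in, why uniqueness is drawn
    from vanishing contour integrals alone, and why the disc is punctured.

    The exponential substitution lets a single real segment on which the difference vanishes serve
    every angle. Its price is that the half-width of the rectangle must exceed its height, an angle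
    up to 2 PI, so the rectangle spreads to radii larger by a factor exp 9 and the disc shrinks
    accordingly. The loss is harmless: the Euler-Maclaurin expression of order m is available on a
    disc of radius m + 1 and m is free, so every non-positive integer is reached. Since agreement is
    needed only for real s > 1, all integrations by parts stay real.

    [pole_res] also demands nonzero residues. For the poles at s = -2k this is the non-vanishing of
    the even Bernoulli numbers, obtained from the signs of the odd Bernoulli polynomials. *)

Definition has_cderiv (f : C -> C) (z l : C) : Prop :=
  forall eps : R, 0 < eps -> exists d : R, 0 < d /\ forall h : C, Cmod h < d ->
    Cmod (f (z + h) - f z - l * h)%C <= eps * Cmod h.

Lemma Cplus_minus_cancel (z y : C) : (z + (y - z))%C = y.
Proof. ring. Qed.

Lemma Cplus_minus_cancel_l (z h : C) : (z + h - z)%C = h.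
Proof. ring. Qed.

Lemma has_cderiv_iff_is_derive (f : C -> C) (z l : C) :
  has_cderiv f z l <-> @is_derive C_AbsRing (AbsRing_NormedModule C_AbsRing) f z l.
Proof.
  split.
  - intros H; split; [apply (is_linear_scal_l (K := C_AbsRing))|].
    intros x Hx eps.
    apply (is_filter_lim_locally_unique (V := AbsRing_NormedModule C_AbsRing)) in Hx; subst x.
    destruct (H eps (cond_pos eps)) as [d [Hd Hh]].
    exists (mkposreal d Hd); intros y Hy.
    change (Cmod (y - z)%C < d) in Hy.
    specialize (Hh (y - z)%C Hy).
    rewrite Cplus_minus_cancel in Hh.
    change (Cmod ((f y - f z) - (y - z) * l)%C <= eps * Cmod (y - z)%C).
    now rewrite (Cmult_comm (y - z)).
  - intros [_ H] eps Heps.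
    destruct (H z (fun P HP => HP) (mkposreal eps Heps)) as [d Hd].
    exists d; split; [apply cond_pos|].
    intros h Hh.
    assert (Hy : Cmod ((z + h) - z)%C < d) by now rewrite Cplus_minus_cancel_l.
    specialize (Hd (z + h)%C Hy).
    change (Cmod ((f (z + h) - f z) - ((z + h) - z) * l)%C <= eps * Cmod ((z + h) - z)%C) in Hd.
    rewrite Cplus_minus_cancel_l in Hd.
    now rewrite (Cmult_comm l).
Qed.

Lemma has_cderiv_iff_is_derive_C (f : C -> C) (z l : C) :
  has_cderiv f z l <-> @is_derive C_AbsRing C_NormedModule f z l.
Proof.
  split.
  - intros H; apply has_cderiv_iff_is_derive in H; destruct H as [_ H].
    split; [apply (is_linear_scal_l (K := C_AbsRing) (V := C_NormedModule))|].
    exact H.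
  - intros [_ H]; apply has_cderiv_iff_is_derive.
    split; [apply (is_linear_scal_l (K := C_AbsRing))|].
    exact H.
Qed.

Lemma holo_at_iff (f : C -> C) (z : C) : holo_at f z <-> exists l, has_cderiv f z l.
Proof.
  split; intros [l H]; exists l; now apply has_cderiv_iff_is_derive_C.
Qed.

(** [holo_at] lives over [C_NormedModule], while the rules for identity and product, and the inner
    function of the chain rule, live over [AbsRing_NormedModule C_AbsRing]. [has_cderiv] is the
    common ground that allows passing between the two structures. *)
Lemma holo_at_iff_ring (f : C -> C) (z : C) :
  holo_at f z <-> @ex_derive C_AbsRing (AbsRing_NormedModule C_AbsRing) f z.
Proof.
  rewrite holo_at_iff; split; intros [l H]; exists l; now apply has_cderiv_iff_is_derive.
Qed.

Lemma holo_at_ext_loc (f g : C -> C) (z : C) (d : R) :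
  0 < d -> (forall y, Cmod (y - z)%C < d -> f y = g y) -> holo_at f z -> holo_at g z.
Proof.
  intros Hd Hfg; rewrite !holo_at_iff; intros [l H]; exists l; intros eps Heps.
  destruct (H eps Heps) as [d' [Hd' Hh]].
  exists (Rmin d d'); split; [now apply Rmin_glb_lt|].
  intros h Hlt.
  assert (Cmod h < d) by (eapply Rlt_le_trans; [exact Hlt|apply Rmin_l]).
  assert (Cmod h < d') by (eapply Rlt_le_trans; [exact Hlt|apply Rmin_r]).
  rewrite <- !Hfg.
  - now apply Hh.
  - replace (z - z)%C with (RtoC 0) by ring. now rewrite Cmod_0.
  - now replace (z + h - z)%C with h by ring.
Qed.

Lemma holo_at_ext (f g : C -> C) (z : C) :
  (forall y, f y = g y) -> holo_at f z -> holo_at g z.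
Proof. intros H; apply holo_at_ext_loc with 1; [lra|]; intros; apply H. Qed.

Lemma holo_at_const (c z : C) : holo_at (fun _ => c) z.
Proof. exists zero; apply (is_derive_const (K := C_AbsRing) (V := C_NormedModule)). Qed.

Lemma holo_at_id (z : C) : holo_at (fun y => y) z.
Proof. apply holo_at_iff_ring; exists one; apply is_derive_id. Qed.

Lemma holo_at_plus (f g : C -> C) (z : C) :
  holo_at f z -> holo_at g z -> holo_at (fun y => f y + g y)%C z.
Proof. intros [a Ha] [b Hb]; exists (plus a b); now apply (is_derive_plus (K := C_AbsRing) (V := C_NormedModule)). Qed.

Lemma holo_at_opp (f : C -> C) (z : C) : holo_at f z -> holo_at (fun y => - f y)%C z.
Proof. intros [a Ha]; exists (opp a); now apply (is_derive_opp (K := C_AbsRing) (V := C_NormedModule)). Qed.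

Lemma holo_at_minus (f g : C -> C) (z : C) :
  holo_at f z -> holo_at g z -> holo_at (fun y => f y - g y)%C z.
Proof. intros Hf Hg; apply holo_at_plus; [exact Hf|now apply holo_at_opp]. Qed.

Lemma holo_at_mult (f g : C -> C) (z : C) :
  holo_at f z -> holo_at g z -> holo_at (fun y => f y * g y)%C z.
Proof.
  rewrite !holo_at_iff_ring; intros [a Ha] [b Hb].
  eexists; apply (is_derive_mult (K := C_AbsRing)); [exact Ha|exact Hb|apply Cmult_comm].
Qed.

Lemma holo_at_comp (f g : C -> C) (z : C) :
  holo_at f (g z) -> holo_at g z -> holo_at (fun y => f (g y)) z.
Proof.
  rewrite (holo_at_iff_ring g); intros Hf Hg.
  now apply (ex_derive_comp (K := C_AbsRing) (V := C_NormedModule)).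
Qed.

Lemma holo_at_shift (f : C -> C) (a z : C) :
  holo_at f (z + a)%C -> holo_at (fun y => f (y + a)%C) z.
Proof.
  intros H; apply (holo_at_comp f (fun y => y + a)%C); [exact H|].
  apply holo_at_plus; [apply holo_at_id|apply holo_at_const].
Qed.

(** A quadratic remainder is a stronger demand than differentiability, but it passes through series
    and integrals by mere summation of bounds. The derivatives of the inverse, the exponential and
    the parameter series all go through it. *)
Lemma holo_at_quadratic (f : C -> C) (z l : C) (K d : R) : 0 < d ->
  (forall h, Cmod h < d -> Cmod (f (z + h) - f z - l * h)%C <= K * Cmod h ^ 2) ->
  holo_at f z.
Proof.
  intros Hd H; apply holo_at_iff; exists l; intros eps Heps.
  assert (HK : 0 < eps / (Rabs K + 1)).
  { apply Rdiv_lt_0_compat; [lra|]; pose proof (Rabs_pos K); lra. }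
  exists (Rmin d (eps / (Rabs K + 1))); split; [now apply Rmin_glb_lt|].
  intros h Hh.
  assert (H1 : Cmod h < d) by (eapply Rlt_le_trans; [exact Hh|apply Rmin_l]).
  assert (H2 : Cmod h < eps / (Rabs K + 1)) by (eapply Rlt_le_trans; [exact Hh|apply Rmin_r]).
  pose proof (Cmod_ge_0 h); pose proof (Rabs_pos K); pose proof (Rle_abs K).
  apply Rle_trans with (1 := H h H1).
  apply Rmult_lt_compat_r with (r := Rabs K + 1) in H2; [|lra].
  unfold Rdiv in H2; rewrite Rmult_assoc, Rinv_l, Rmult_1_r in H2 by lra.
  simpl; nra.
Qed.

Lemma Cmod_triangle_rev (x y : C) : Cmod x - Cmod y <= Cmod (x + y)%C.
Proof.
  pose proof (Cmod_triangle (x + y) (- y)).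
  replace (x + y + - y)%C with x in H by ring. rewrite Cmod_opp in H. lra.
Qed.

Lemma holo_at_inv (z : C) : z <> RtoC 0 -> holo_at Cinv z.
Proof.
  intros Hz; pose proof (proj1 (Cmod_gt_0 z) Hz) as Hp.
  apply holo_at_quadratic with (- / (z * z))%C (2 / (Cmod z ^ 3)) (Cmod z / 2); [lra|].
  intros h Hh.
  pose proof (Cmod_triangle_rev z h).
  assert (Hzh : (z + h)%C <> RtoC 0) by (apply Cmod_gt_0; lra).
  replace (/ (z + h) - / z - - / (z * z) * h)%C with (h * h * / (z * z * (z + h)))%C by (field; auto).
  rewrite !Cmod_mult, Cmod_inv, !Cmod_mult by (repeat apply Cmult_neq_0; auto).
  replace (2 / Cmod z ^ 3 * Cmod h ^ 2) with (Cmod h * Cmod h * / (Cmod z * Cmod z * (Cmod z / 2)))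
    by (field; lra).
  pose proof (Cmod_ge_0 h).
  apply Rmult_le_compat_l; [nra|].
  apply Rinv_le_contravar; [repeat apply Rmult_lt_0_compat; lra|].
  apply Rmult_le_compat_l; nra.
Qed.

(** * The complex exponential and its quadratic remainder *)

Lemma Cmod_le_sum (z : C) : Cmod z <= Rabs (Re z) + Rabs (Im z).
Proof.
  destruct z as [a b]; unfold Cmod; simpl fst; simpl snd; unfold Re, Im; simpl.
  pose proof (Rabs_pos a); pose proof (Rabs_pos b).
  apply Rle_trans with (sqrt ((Rabs a + Rabs b) ^ 2)).
  - apply sqrt_le_1_alt. pose proof (pow2_abs a); pose proof (pow2_abs b). simpl in *; nra.
  - rewrite sqrt_pow2; lra.
Qed.

Lemma im_le_Cmod (z : C) : Rabs (Im z) <= Cmod z.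
Proof. apply Rle_trans with (2 := Rmax_Cmod z), Rmax_r. Qed.

Lemma Cmult_pair (a b c d : R) : Cmult (a, b) (c, d) = (a * c - b * d, a * d + b * c).
Proof. reflexivity. Qed.

Definition cexp (z : C) : C := (exp (Re z) * cos (Im z), exp (Re z) * sin (Im z)).

Lemma cexp_plus (a b : C) : cexp (a + b)%C = (cexp a * cexp b)%C.
Proof.
  unfold cexp; rewrite re_plus, im_plus, exp_plus, cos_plus, sin_plus, Cmult_pair.
  f_equal; ring.
Qed.

Lemma Cmod_cexp (z : C) : Cmod (cexp z) = exp (Re z).
Proof.
  unfold cexp, Cmod; simpl fst; simpl snd.
  replace ((exp (Re z) * cos (Im z)) ^ 2 + (exp (Re z) * sin (Im z)) ^ 2)
    with (exp (Re z) ^ 2 * (Rsqr (sin (Im z)) + Rsqr (cos (Im z)))) by (unfold Rsqr; ring).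
  rewrite sin2_cos2, Rmult_1_r; apply sqrt_pow2, Rlt_le, exp_pos.
Qed.

Lemma cexp_RtoC (x : R) : cexp (RtoC x) = RtoC (exp x).
Proof. unfold cexp; rewrite re_RtoC, im_RtoC, cos_0, sin_0; unfold RtoC; f_equal; ring. Qed.

Lemma cpow_cexp (x : R) (s : C) : cpow x s = cexp (s * RtoC (ln x))%C.
Proof. unfold cpow, cexp; now rewrite re_scal_r, im_scal_r. Qed.

Lemma exp_le (x y : R) : x <= y -> exp x <= exp y.
Proof. intros [H| ->]; [left; now apply exp_increasing|lra]. Qed.

(** Everything follows from 1 + x <= exp x at a and at -a, linked by exp a * exp (-a) = 1. The next
    lemma uses the same device. *)
Lemma exp_minus_1_le (a : R) : Rabs (exp a - 1) <= Rabs a * exp (Rabs a).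
Proof.
  pose proof (exp_ineq1_le a); pose proof (exp_ineq1_le (- a)).
  assert (exp a * exp (- a) = 1) by (rewrite <- exp_plus, Rplus_opp_r; apply exp_0).
  pose proof (exp_pos a); pose proof (exp_pos (- a)).
  unfold Rabs at 2 3; destruct (Rcase_abs a); apply Rabs_le; split; nra.
Qed.

Lemma exp_remainder_le (a : R) : Rabs (exp a - 1 - a) <= a ^ 2 * exp (Rabs a).
Proof.
  pose proof (exp_ineq1_le a); pose proof (exp_ineq1_le (- a)).
  assert (exp a * exp (- a) = 1) by (rewrite <- exp_plus, Rplus_opp_r; apply exp_0).
  pose proof (exp_pos a); pose proof (exp_pos (- a)).
  assert (exp a - 1 <= a * exp a) by nra.
  rewrite Rabs_pos_eq by lra.
  unfold Rabs; destruct (Rcase_abs a).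
  - assert (1 <= exp (- a)) by lra. assert (exp a - 1 - a <= a * a) by nra. simpl; nra.
  - simpl; nra.
Qed.

Lemma Rabs_sin_le (x : R) : Rabs (sin x) <= Rabs x.
Proof.
  destruct (MVT_gen sin 0 x cos) as [c [_ Hc]].
  - intros; auto_derive; [trivial|ring].
  - intros; apply continuity_sin.
  - rewrite sin_0, !Rminus_0_r in Hc; rewrite Hc, Rabs_mult.
    pose proof (COS_bound c). assert (Rabs (cos c) <= 1) by (apply Rabs_le; lra).
    pose proof (Rabs_pos x). nra.
Qed.

Lemma cos_minus_1 (x : R) : cos x - 1 = - 2 * sin (x / 2) ^ 2.
Proof.
  replace x with (2 * (x / 2)) at 1 by field. rewrite cos_2a_sin. ring.
Qed.

Lemma Rabs_cos_minus_1_le_sq (x : R) : Rabs (cos x - 1) <= x ^ 2 / 2.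
Proof.
  rewrite cos_minus_1, Rabs_mult, <- RPow_abs, Rabs_left by lra.
  pose proof (Rabs_sin_le (x / 2)). pose proof (Rabs_pos (sin (x / 2))).
  pose proof (pow2_abs (x / 2)). simpl in *; nra.
Qed.

Lemma Rabs_cos_minus_1_le (x : R) : Rabs (cos x - 1) <= Rabs x.
Proof.
  rewrite cos_minus_1, Rabs_mult, <- RPow_abs, (Rabs_left (-2)) by lra.
  pose proof (Rabs_sin_le (x / 2)) as H. pose proof (Rabs_pos (sin (x / 2))).
  pose proof (SIN_bound (x / 2)). assert (Rabs (sin (x / 2)) <= 1) by (apply Rabs_le; lra).
  unfold Rdiv in H at 2; rewrite Rabs_mult, (Rabs_pos_eq (/ 2)) in H by lra.
  simpl in *; nra.
Qed.

Lemma Rabs_sin_minus_le_sq (x : R) : Rabs (sin x - x) <= x ^ 2.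
Proof.
  destruct (MVT_gen (fun y => sin y - y) 0 x (fun y => cos y - 1)) as [c [Hb Hc]].
  - intros; auto_derive; [trivial|ring].
  - intros; apply continuity_pt_minus; [apply continuity_sin|apply continuity_pt_id].
  - rewrite sin_0, !Rminus_0_r in Hc; rewrite Hc, Rabs_mult.
    pose proof (Rabs_cos_minus_1_le c).
    assert (Rabs c <= Rabs x).
    { unfold Rmin, Rmax in Hb; destruct (Rle_dec 0 x); unfold Rabs;
        destruct (Rcase_abs c), (Rcase_abs x); lra. }
    rewrite <- (pow2_abs x). pose proof (Rabs_pos x); simpl; nra.
Qed.

Lemma cexp_remainder_bounds (a b : R) :
  Rabs (exp a * cos b - 1 - a) <= exp (Rabs a) * (a ^ 2 + b ^ 2) /\
  Rabs (exp a * sin b - b) <= exp (Rabs a) * (a ^ 2 + 2 * b ^ 2).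
Proof.
  pose proof (exp_pos a); pose proof (exp_pos (Rabs a)).
  assert (exp a <= exp (Rabs a)) by apply exp_le, Rle_abs.
  split.
  - replace (exp a * cos b - 1 - a) with ((exp a - 1 - a) + exp a * (cos b - 1)) by ring.
    apply Rle_trans with (1 := Rabs_triang _ _).
    rewrite Rabs_mult, (Rabs_pos_eq (exp a)) by lra.
    pose proof (exp_remainder_le a); pose proof (Rabs_cos_minus_1_le_sq b).
    pose proof (Rabs_pos (cos b - 1)).
    assert (exp a * Rabs (cos b - 1) <= exp (Rabs a) * (b ^ 2 / 2))
      by (apply Rmult_le_compat; lra).
    pose proof (pow2_ge_0 b). nra.
  - replace (exp a * sin b - b) with (exp a * (sin b - b) + (exp a - 1) * b) by ring.
    apply Rle_trans with (1 := Rabs_triang _ _).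
    rewrite !Rabs_mult, (Rabs_pos_eq (exp a)) by lra.
    pose proof (exp_minus_1_le a); pose proof (Rabs_sin_minus_le_sq b).
    pose proof (Rabs_pos (sin b - b)); pose proof (Rabs_pos b).
    assert (exp a * Rabs (sin b - b) <= exp (Rabs a) * b ^ 2) by (apply Rmult_le_compat; lra).
    assert (Rabs (exp a - 1) * Rabs b <= Rabs a * exp (Rabs a) * Rabs b)
      by (apply Rmult_le_compat_r; lra).
    assert (Rabs a * Rabs b <= a ^ 2 + b ^ 2).
    { rewrite <- (pow2_abs a), <- (pow2_abs b). pose proof (pow2_ge_0 (Rabs a - Rabs b)).
      pose proof (Rabs_pos a). simpl in *; nra. }
    assert (exp (Rabs a) * (Rabs a * Rabs b) <= exp (Rabs a) * (a ^ 2 + b ^ 2))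
      by (apply Rmult_le_compat_l; lra).
    lra.
Qed.

(** The 3 comes from adding the bounds of the two components: (a^2 + b^2) + (a^2 + 2 b^2) <= 3 (a^2
    + b^2). *)
Lemma cexp_remainder (h : C) : Cmod (cexp h - 1 - h)%C <= 3 * exp (Cmod h) * Cmod h ^ 2.
Proof.
  destruct (cexp_remainder_bounds (Re h) (Im h)) as [H1 H2].
  apply Rle_trans with (1 := Cmod_le_sum _).
  replace (Re (cexp h - 1 - h)%C) with (exp (Re h) * cos (Im h) - 1 - Re h)
    by (unfold cexp, Cminus; rewrite !re_plus, !re_opp, re_RtoC; simpl; ring).
  replace (Im (cexp h - 1 - h)%C) with (exp (Re h) * sin (Im h) - Im h)
    by (unfold cexp, Cminus; rewrite !im_plus, !im_opp, im_RtoC; simpl; ring).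
  pose proof (re_le_Cmod h) as Hre.
  assert (He : exp (Rabs (Re h)) <= exp (Cmod h)) by now apply exp_le.
  rewrite Cmod2_alt. pose proof (exp_pos (Rabs (Re h))).
  pose proof (pow2_ge_0 (Re h)); pose proof (pow2_ge_0 (Im h)).
  nra.
Qed.

Lemma holo_at_cexp (z : C) : holo_at cexp z.
Proof.
  apply holo_at_quadratic with (cexp z) (Cmod (cexp z) * (3 * exp 1)) 1; [lra|].
  intros h Hh; rewrite cexp_plus.
  replace (cexp z * cexp h - cexp z - cexp z * h)%C with (cexp z * (cexp h - 1 - h))%C by ring.
  rewrite Cmod_mult.
  rewrite Rmult_assoc; apply Rmult_le_compat_l; [apply Cmod_ge_0|].
  apply Rle_trans with (1 := cexp_remainder h).
  apply Rmult_le_compat_r; [apply pow2_ge_0|].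
  apply Rmult_le_compat_l; [lra|]. left; now apply exp_increasing.
Qed.

(** * Goursat's theorem on rectangles *)

(** The coefficient [p2] common to both expansions says that dP/dy = dQ/dx at the point, so P dx + Q
    dy is closed there. Stated pointwise, it is exactly what the bisection argument consumes, and
    both the real and the imaginary part of f dz have this form. *)
Definition closed_form_at (P Q : R -> R -> R) (x y : R) : Prop :=
  exists p1 p2 q2 : R, forall eps : R, 0 < eps -> exists d : R, 0 < d /\
    forall x' y', Rabs (x' - x) < d -> Rabs (y' - y) < d ->
    Rabs (P x' y' - P x y - p1 * (x' - x) - p2 * (y' - y))
      <= eps * (Rabs (x' - x) + Rabs (y' - y)) /\
    Rabs (Q x' y' - Q x y - p2 * (x' - x) - q2 * (y' - y))
      <= eps * (Rabs (x' - x) + Rabs (y' - y)).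

(** Counterclockwise around [a, b] x [c, d]: bottom, reversed top, right, reversed left. *)
Definition loop_integral (P Q : R -> R -> R) (a b c d : R) : R :=
  RInt (fun x => P x c) a b - RInt (fun x => P x d) a b
  + RInt (fun y => Q b y) c d - RInt (fun y => Q a y) c d.

Lemma nested_intervals (u w : nat -> R) :
  (forall k, u k <= u (S k)) -> (forall k, u (S k) + w (S k) <= u k + w k) ->
  (forall k, 0 <= w k) -> exists x, forall k, u k <= x <= u k + w k.
Proof.
  intros Hu Hw Hp.
  assert (Hmono : forall k j, u k <= u (k + j)%nat /\ u (k + j)%nat + w (k + j)%nat <= u k + w k).
  { intros k j; induction j as [|j [I1 I2]]; [rewrite Nat.add_0_r; lra|].
    rewrite Nat.add_succ_r. specialize (Hu (k + j)%nat); specialize (Hw (k + j)%nat). lra. }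
  assert (Hle : forall k j, u j <= u k + w k).
  { intros k j. destruct (le_ge_dec k j) as [H|H].
    - destruct (Hmono k (j - k)%nat) as [_ H2]. replace (k + (j - k))%nat with j in H2 by lia.
      specialize (Hp j); lra.
    - destruct (Hmono j (k - j)%nat) as [H1 _]. replace (j + (k - j))%nat with k in H1 by lia.
      specialize (Hp k); lra. }
  destruct (completeness (fun r => exists k, r = u k)) as [x [Hx1 Hx2]].
  - exists (u 0%nat + w 0%nat); intros r [k ->]; apply Hle.
  - exists (u 0%nat); now exists 0%nat.
  - exists x; intros k; split.
    + apply Hx1; now exists k.
    + apply Hx2; intros r [j ->]; apply Hle.
Qed.

(** Continuity is needed only along the direction in which each component is integrated. The
    expansion with eps = 1 already bounds increments linearly. *)
Lemma closed_form_at_continuous (P Q : R -> R -> R) (x y : R) :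
  closed_form_at P Q x y ->
  continuous (fun x => P x y) x /\ continuous (fun y => Q x y) y.
Proof.
  intros (p1 & p2 & q2 & H).
  destruct (H 1 Rlt_0_1) as [d [Hd Hdd]].
  assert (Hk : forall k e, 0 < e -> 0 < e / (Rabs k + 2)).
  { intros k e He; apply Rdiv_lt_0_compat; [lra|]; pose proof (Rabs_pos k); lra. }
  assert (Hkey : forall (f : R -> R) k z,
    (forall z', Rabs (z' - z) < d -> Rabs (f z' - f z - k * (z' - z)) <= Rabs (z' - z)) ->
    continuous f z).
  { intros f k z Hf. apply continuity_pt_filterlim. intros e He.
    exists (Rmin d (e / (Rabs k + 2))); split; [apply Rmin_glb_lt; auto|].
    intros z' [_ Hz']; unfold dist in *; simpl in *; unfold Rdist in *.
    assert (H1 : Rabs (z' - z) < d) by (eapply Rlt_le_trans; [exact Hz'|apply Rmin_l]).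
    assert (H2 : Rabs (z' - z) < e / (Rabs k + 2)) by (eapply Rlt_le_trans; [exact Hz'|apply Rmin_r]).
    specialize (Hf z' H1).
    replace (f z' - f z) with ((f z' - f z - k * (z' - z)) + k * (z' - z)) by ring.
    apply Rle_lt_trans with (1 := Rabs_triang _ _). rewrite Rabs_mult.
    pose proof (Rabs_pos k); pose proof (Rabs_pos (z' - z)).
    apply Rmult_lt_compat_r with (r := Rabs k + 2) in H2; [|lra].
    unfold Rdiv in H2; rewrite Rmult_assoc, Rinv_l, Rmult_1_r in H2 by lra. nra. }
  split.
  - apply (Hkey (fun x => P x y) p1); intros z Hz.
    destruct (Hdd z y Hz) as [H1 _]; [rewrite Rminus_diag, Rabs_R0; lra|].
    rewrite Rminus_diag, Rabs_R0 in H1. rewrite Rmult_0_r, Rminus_0_r, Rplus_0_r, Rmult_1_l in H1. exact H1.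
  - apply (Hkey (fun y => Q x y) q2); intros z Hz.
    destruct (Hdd x z) as [_ H1]; [rewrite Rminus_diag, Rabs_R0; lra|exact Hz|].
    rewrite Rminus_diag, Rabs_R0 in H1. rewrite Rmult_0_r, Rminus_0_r, Rplus_0_l, Rmult_1_l in H1. exact H1.
Qed.

Section Rectangle.

Variables (P Q : R -> R -> R) (a0 b0 c0 d0 : R).
Hypothesis Hform : forall x y, a0 <= x <= b0 -> c0 <= y <= d0 -> closed_form_at P Q x y.

Lemma ex_RInt_horizontal a b y :
  a0 <= a -> a <= b -> b <= b0 -> c0 <= y <= d0 -> ex_RInt (fun x => P x y) a b.
Proof.
  intros Ha Hab Hb Hy; apply (ex_RInt_continuous (V := R_CompleteNormedModule)); intros x Hx.
  rewrite Rmin_left, Rmax_right in Hx by lra.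
  apply (closed_form_at_continuous P Q); apply Hform; lra.
Qed.

Lemma ex_RInt_vertical c d x :
  c0 <= c -> c <= d -> d <= d0 -> a0 <= x <= b0 -> ex_RInt (fun y => Q x y) c d.
Proof.
  intros Hc Hcd Hd Hx; apply (ex_RInt_continuous (V := R_CompleteNormedModule)); intros y Hy.
  rewrite Rmin_left, Rmax_right in Hy by lra.
  apply (closed_form_at_continuous P Q); apply Hform; lra.
Qed.

Lemma loop_integral_quarter a b c d m n :
  a0 <= a -> a <= m -> m <= b -> b <= b0 -> c0 <= c -> c <= n -> n <= d -> d <= d0 ->
  loop_integral P Q a b c d =
    loop_integral P Q a m c n + loop_integral P Q m b c n
    + loop_integral P Q a m n d + loop_integral P Q m b n d.
Proof.
  intros; unfold loop_integral.
  rewrite <- (RInt_Chasles (fun x => P x c) a m b) by (apply ex_RInt_horizontal; lra).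
  rewrite <- (RInt_Chasles (fun x => P x d) a m b) by (apply ex_RInt_horizontal; lra).
  rewrite <- (RInt_Chasles (fun y => Q b y) c n d) by (apply ex_RInt_vertical; lra).
  rewrite <- (RInt_Chasles (fun y => Q a y) c n d) by (apply ex_RInt_vertical; lra).
  unfold plus; simpl; ring.
Qed.

Lemma RInt_near_affine (f : R -> R) (a b k l e : R) : a <= b -> ex_RInt f a b ->
  (forall x, a <= x <= b -> Rabs (f x - (k + l * x)) <= e) ->
  Rabs (RInt f a b - (k * (b - a) + l * (b ^ 2 - a ^ 2) / 2)) <= (b - a) * e.
Proof.
  intros Hab Hf He.
  assert (Haff : is_RInt (fun x => k + l * x) a b (k * (b - a) + l * (b ^ 2 - a ^ 2) / 2)).
  { replace (k * (b - a) + l * (b ^ 2 - a ^ 2) / 2)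
      with (minus (k * b + l * b ^ 2 / 2) (k * a + l * a ^ 2 / 2))
      by (unfold minus, plus, opp; simpl; field).
    apply (is_RInt_derive (V := R_CompleteNormedModule) (fun x => k * x + l * x ^ 2 / 2)).
    - intros; auto_derive; [trivial|field].
    - intros; apply (ex_derive_continuous (V := R_NormedModule)); auto_derive; trivial. }
  assert (Hdiff : is_RInt (fun x => f x - (k + l * x)) a b
     (RInt f a b - (k * (b - a) + l * (b ^ 2 - a ^ 2) / 2))).
  { apply (is_RInt_minus (V := R_NormedModule)); [|exact Haff].
    now apply (RInt_correct (V := R_CompleteNormedModule)). }
  exact (norm_RInt_le_const (V := R_NormedModule) _ a b _ e Hab He Hdiff).
Qed.

(** The affine parts cancel: the horizontal sides contribute -p2 (d - c) (b - a) and the vertical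
    sides the opposite. What is left is a remainder of at most eps times the half perimeter,
    integrated over the perimeter. *)
Lemma loop_integral_local u v : a0 <= u <= b0 -> c0 <= v <= d0 ->
  forall eps, 0 < eps -> exists del, 0 < del /\
  forall a b c d, a0 <= a -> a <= u <= b -> b <= b0 -> c0 <= c -> c <= v <= d -> d <= d0 ->
    b - a < del -> d - c < del ->
    Rabs (loop_integral P Q a b c d) <= 2 * eps * ((b - a) + (d - c)) ^ 2.
Proof.
  intros Hu Hv eps Heps.
  destruct (Hform u v Hu Hv) as (p1 & p2 & q2 & H).
  destruct (H eps Heps) as [del [Hdel Hd]].
  exists del; split; [exact Hdel|].
  intros a b c d Ha Hab Hb Hc Hcd Hdd Hw Hh.
  set (e := eps * ((b - a) + (d - c))).
  assert (HP : forall x y, a <= x <= b -> c <= y <= d ->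
    Rabs (P x y - ((P u v - p1 * u + p2 * (y - v)) + p1 * x)) <= e /\
    Rabs (Q x y - ((Q u v - q2 * v + p2 * (x - u)) + q2 * y)) <= e).
  { intros x y Hx Hy.
    assert (X1 : Rabs (x - u) <= b - a) by (apply Rabs_le; lra).
    assert (Y1 : Rabs (y - v) <= d - c) by (apply Rabs_le; lra).
    destruct (Hd x y) as [H1 H2]; [lra|lra|].
    assert (eps * (Rabs (x - u) + Rabs (y - v)) <= e)
      by (apply Rmult_le_compat_l; lra).
    split.
    - replace (P x y - (P u v - p1 * u + p2 * (y - v) + p1 * x))
        with (P x y - P u v - p1 * (x - u) - p2 * (y - v)) by ring. lra.
    - replace (Q x y - (Q u v - q2 * v + p2 * (x - u) + q2 * y))
        with (Q x y - Q u v - p2 * (x - u) - q2 * (y - v)) by ring. lra. }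
  assert (E1 := RInt_near_affine (fun x => P x c) a b _ _ e ltac:(lra)
     ltac:(apply ex_RInt_horizontal; lra) (fun x Hx => proj1 (HP x c Hx ltac:(lra)))).
  assert (E2 := RInt_near_affine (fun x => P x d) a b _ _ e ltac:(lra)
     ltac:(apply ex_RInt_horizontal; lra) (fun x Hx => proj1 (HP x d Hx ltac:(lra)))).
  assert (E3 := RInt_near_affine (fun y => Q b y) c d _ _ e ltac:(lra)
     ltac:(apply ex_RInt_vertical; lra) (fun y Hy => proj2 (HP b y ltac:(lra) Hy))).
  assert (E4 := RInt_near_affine (fun y => Q a y) c d _ _ e ltac:(lra)
     ltac:(apply ex_RInt_vertical; lra) (fun y Hy => proj2 (HP a y ltac:(lra) Hy))).
  replace (2 * eps * (b - a + (d - c)) ^ 2) with (2 * ((b - a) * e + (d - c) * e))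
    by (unfold e; ring).
  unfold loop_integral.
  apply Rabs_le_between in E1, E2, E3, E4. apply Rabs_le. nra.
Qed.

Let W := b0 - a0.
Let H := d0 - c0.

(** The threshold is quadratic in the size, so halving the sides divides it by 4 and a bad rectangle
    has a bad quarter. *)
Let bad (eps a c w h : R) : Prop :=
  eps * (w + h) ^ 2 < Rabs (loop_integral P Q a (a + w) c (c + h)).

(** Only the lower left corner is tracked, the sides being determined by k. The fourth quarter is
    taken without a test: it is bad whenever the whole is bad and the other three are not. *)
Let step (eps : R) (k : nat) (p : R * R) : R * R :=
  let w := W / 2 ^ S k in let h := H / 2 ^ S k in
  let a := fst p in let c := snd p in
  let q x y := Rlt_dec (eps * (w + h) ^ 2) (Rabs (loop_integral P Q x (x + w) y (y + h))) in
  if q a c then (a, c) else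
  if q (a + w) c then (a + w, c) else
  if q a (c + h) then (a, c + h) else (a + w, c + h).

Let corner (eps : R) := nat_rec (fun _ => (R * R)%type) (a0, c0) (step eps).

Theorem loop_integral_eq_0 : a0 <= b0 -> c0 <= d0 -> loop_integral P Q a0 b0 c0 d0 = 0.
Proof.
  intros Hab Hcd.
  assert (HW : 0 <= W) by (unfold W; lra). assert (HH : 0 <= H) by (unfold H; lra).
  assert (Hhalf : forall z k, z / 2 ^ S k = z / 2 ^ k / 2).
  { intros z k; simpl; field; apply pow_nonzero; lra. }
  assert (Hpos : forall z k, 0 <= z -> 0 <= z / 2 ^ k).
  { intros z k Hz; apply Rmult_le_pos; [lra|]; left; apply Rinv_0_lt_compat, pow_lt; lra. }
  assert (Hsmall : forall eps, 0 < eps -> ~ bad eps a0 c0 W H).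
  { intros eps Heps Hbad.
    set (A k := fst (corner eps k)). set (B k := snd (corner eps k)).
    assert (Hstep : forall k,
      (A (S k) = A k \/ A (S k) = A k + W / 2 ^ k / 2) /\
      (B (S k) = B k \/ B (S k) = B k + H / 2 ^ k / 2)).
    { intros k; unfold A, B; change (corner eps (S k)) with (step eps k (corner eps k)).
      unfold step. rewrite !Hhalf. repeat destruct Rlt_dec; simpl; auto. }
    assert (HA0 : A 0%nat = a0) by reflexivity.
    assert (HB0 : B 0%nat = c0) by reflexivity.
    assert (HAin : forall k, a0 <= A k /\ A k + W / 2 ^ k <= b0).
    { induction k as [|k IH]; [rewrite HA0; simpl; unfold W, Rdiv; lra|].
      destruct (Hstep k) as [[E|E] _]; rewrite E, Hhalf; pose proof (Hpos W k HW); lra. }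
    assert (HBin : forall k, c0 <= B k /\ B k + H / 2 ^ k <= d0).
    { induction k as [|k IH]; [rewrite HB0; simpl; unfold H, Rdiv; lra|].
      destruct (Hstep k) as [_ [E|E]]; rewrite E, Hhalf; pose proof (Hpos H k HH); lra. }
    assert (Hbadk : forall k, bad eps (A k) (B k) (W / 2 ^ k) (H / 2 ^ k)).
    { induction k as [|k IH].
      - rewrite HA0, HB0; simpl; unfold Rdiv; rewrite Rinv_1, !Rmult_1_r; exact Hbad.
      - unfold bad in *. rewrite !Hhalf in *.
        set (w := W / 2 ^ k) in *. set (h := H / 2 ^ k) in *.
        unfold A at 1 2, B at 1 2; change (corner eps (S k)) with (step eps k (corner eps k)).
        fold A B.
        unfold step. fold (A k) (B k). rewrite !Hhalf. fold w h.
        destruct Rlt_dec as [L1|L1]; [exact L1|].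
        destruct Rlt_dec as [L2|L2]; [exact L2|].
        destruct Rlt_dec as [L3|L3]; [exact L3|].
        simpl fst; simpl snd.
        apply Rnot_lt_le in L1, L2, L3.
        destruct (HAin k) as [A1 A2]; destruct (HBin k) as [B1 B2]; fold w in A2; fold h in B2.
        pose proof (Hpos W k HW) as PW; pose proof (Hpos H k HH) as PH; fold w in PW; fold h in PH.
        rewrite (loop_integral_quarter _ _ _ _ (A k + w / 2) (B k + h / 2)) in IH by lra.
        apply Rnot_le_lt; intros L4. apply (Rlt_not_le _ _ IH).
        replace (A k + w / 2 + w / 2) with (A k + w) in * by field.
        replace (B k + h / 2 + h / 2) with (B k + h) in * by field.
        eapply Rle_trans; [apply Rabs_triang|].
        eapply Rle_trans; [apply Rplus_le_compat_r, Rabs_triang|].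
        eapply Rle_trans; [apply Rplus_le_compat_r, Rplus_le_compat_r, Rabs_triang|].
        simpl in *; lra. }
    destruct (nested_intervals A (fun k => W / 2 ^ k)) as [u Hu].
    { intros k; destruct (Hstep k) as [[E|E] _]; rewrite E; pose proof (Hpos W k HW); lra. }
    { intros k; destruct (Hstep k) as [[E|E] _]; rewrite E, Hhalf; pose proof (Hpos W k HW); lra. }
    { intros k; now apply Hpos. }
    destruct (nested_intervals B (fun k => H / 2 ^ k)) as [v Hv].
    { intros k; destruct (Hstep k) as [_ [E|E]]; rewrite E; pose proof (Hpos H k HH); lra. }
    { intros k; destruct (Hstep k) as [_ [E|E]]; rewrite E, Hhalf; pose proof (Hpos H k HH); lra. }
    { intros k; now apply Hpos. }
    (* The point (u, v) lies in all the nested rectangles. With eps / 2 the bound of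
       [loop_integral_local] becomes exactly the threshold of [bad]. *)
    destruct (loop_integral_local u v) with (eps := eps / 2) as [del [Hdel Hloc]].
    { specialize (Hu 0%nat). simpl in Hu; rewrite HA0 in Hu; unfold Rdiv in Hu; rewrite Rinv_1 in Hu; unfold W in Hu; lra. }
    { specialize (Hv 0%nat). simpl in Hv; rewrite HB0 in Hv; unfold Rdiv in Hv; rewrite Rinv_1 in Hv; unfold H in Hv; lra. }
    { lra. }
    destruct (pow_lt_1_zero (/ 2) ltac:(rewrite Rabs_pos_eq; lra) (del / (W + H + 1))) as [K HK].
    { apply Rdiv_lt_0_compat; lra. }
    specialize (HK K (le_n K)).
    rewrite pow_inv, Rabs_pos_eq in HK by (left; apply Rinv_0_lt_compat, pow_lt; lra).
    assert (HK' : (W + H + 1) * / 2 ^ K < del).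
    { apply Rmult_lt_compat_l with (r := W + H + 1) in HK; [|lra].
      replace ((W + H + 1) * (del / (W + H + 1))) with del in HK by (field; lra). exact HK. }
    assert (P2 : 0 < / 2 ^ K) by (apply Rinv_0_lt_compat, pow_lt; lra).
    destruct (HAin K), (HBin K). specialize (Hu K); specialize (Hv K). simpl in Hu, Hv.
    apply (Rlt_not_le _ _ (Hbadk K)).
    eapply Rle_trans; [apply Hloc; solve [lra|unfold Rdiv; nra]|].
    right; field. apply pow_nonzero; lra. }
  destruct (Req_dec (loop_integral P Q a0 b0 c0 d0) 0) as [E|E]; [exact E|exfalso].
  apply Rabs_pos_lt in E.
  assert (HD : 0 < (W + H + 1) ^ 2) by (apply pow_lt; lra).
  (* This eps puts the threshold at no more than half of the supposedly nonzero integral. The 1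
     keeps the denominator positive for a degenerate rectangle. *)
  apply (Hsmall (Rabs (loop_integral P Q a0 b0 c0 d0) / 2 / (W + H + 1) ^ 2)).
  { apply Rdiv_lt_0_compat; lra. }
  unfold bad. replace (a0 + W) with b0 by (unfold W; ring). replace (c0 + H) with d0 by (unfold H; ring).
  set (x := Rabs _) in *.
  apply Rle_lt_trans with (x / 2); [|lra].
  replace (x / 2) with (x / 2 / (W + H + 1) ^ 2 * (W + H + 1) ^ 2) at 2 by (field; lra).
  apply Rmult_le_compat_l; [left; apply Rdiv_lt_0_compat; lra|].
  apply pow_incr; lra.
Qed.

End Rectangle.

(** * Uniqueness of continuation to a punctured disc *)

(** With f = u + i v, f dz = (u dx - v dy) + i (v dx + u dy). The Cauchy-Riemann equations,
    contained in multiplication by one complex number l1 + i l2, are the closedness of the two real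
    forms. *)
Lemma holo_at_closed_forms (f : C -> C) (x y : R) : holo_at f (x, y) ->
  closed_form_at (fun x y => Re (f (x, y))) (fun x y => - Im (f (x, y))) x y /\
  closed_form_at (fun x y => Im (f (x, y))) (fun x y => Re (f (x, y))) x y.
Proof.
  intros H; apply holo_at_iff in H; destruct H as [[l1 l2] H].
  assert (Hkey : forall eps, 0 < eps -> exists d, 0 < d /\ forall x' y',
    Rabs (x' - x) < d -> Rabs (y' - y) < d ->
    Rabs (Re (f (x', y')) - Re (f (x, y)) - (l1 * (x' - x) - l2 * (y' - y)))
      <= eps * (Rabs (x' - x) + Rabs (y' - y)) /\
    Rabs (Im (f (x', y')) - Im (f (x, y)) - (l1 * (y' - y) + l2 * (x' - x)))
      <= eps * (Rabs (x' - x) + Rabs (y' - y))).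
  { intros eps Heps; destruct (H eps Heps) as [d [Hd Hh]].
    exists (d / 2); split; [lra|]; intros x' y' Hx Hy.
    assert (Hm : Cmod (x' - x, y' - y) <= Rabs (x' - x) + Rabs (y' - y)) by apply Cmod_le_sum.
    specialize (Hh (x' - x, y' - y) ltac:(lra)).
    replace (Cplus (x, y) (x' - x, y' - y)) with (x', y') in Hh
      by (unfold Cplus; simpl; f_equal; ring).
    assert (eps * Cmod (x' - x, y' - y) <= eps * (Rabs (x' - x) + Rabs (y' - y)))
      by (apply Rmult_le_compat_l; lra).
    set (z := (f (x', y') - f (x, y) - Cmult (l1, l2) ((x' - x)%R, (y' - y)%R))%C) in *.
    split.
    - replace (Re (f (x', y')) - Re (f (x, y)) - (l1 * (x' - x) - l2 * (y' - y))) with (Re z)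
        by (unfold z, Cminus; rewrite Cmult_pair, !re_plus, !re_opp; simpl; ring).
      pose proof (re_le_Cmod z); lra.
    - replace (Im (f (x', y')) - Im (f (x, y)) - (l1 * (y' - y) + l2 * (x' - x))) with (Im z)
        by (unfold z, Cminus; rewrite Cmult_pair, !im_plus, !im_opp; simpl; ring).
      pose proof (im_le_Cmod z); lra. }
  split.
  - exists l1, (- l2), (- l1); intros eps Heps; destruct (Hkey eps Heps) as [d [Hd Hk]].
    exists d; split; [exact Hd|]; intros x' y' Hx Hy; destruct (Hk x' y' Hx Hy) as [K1 K2]; split.
    + replace (Re (f (x', y')) - Re (f (x, y)) - l1 * (x' - x) - - l2 * (y' - y)) with
       (Re (f (x', y')) - Re (f (x, y)) - (l1 * (x' - x) - l2 * (y' - y))) by ring; exact K1.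
    + rewrite <- Rabs_Ropp.
      replace (- (- Im (f (x', y')) - - Im (f (x, y)) - - l2 * (x' - x) - - l1 * (y' - y))) with
       (Im (f (x', y')) - Im (f (x, y)) - (l1 * (y' - y) + l2 * (x' - x))) by ring; exact K2.
  - exists l2, l1, (- l2); intros eps Heps; destruct (Hkey eps Heps) as [d [Hd Hk]].
    exists d; split; [exact Hd|]; intros x' y' Hx Hy; destruct (Hk x' y' Hx Hy) as [K1 K2]; split.
    + replace (Im (f (x', y')) - Im (f (x, y)) - l2 * (x' - x) - l1 * (y' - y)) with
       (Im (f (x', y')) - Im (f (x, y)) - (l1 * (y' - y) + l2 * (x' - x))) by ring; exact K2.
    + replace (Re (f (x', y')) - Re (f (x, y)) - l1 * (x' - x) - - l2 * (y' - y)) with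
       (Re (f (x', y')) - Re (f (x, y)) - (l1 * (x' - x) - l2 * (y' - y))) by ring; exact K1.
Qed.

Lemma holo_at_continuous_lines (f : C -> C) (x y : R) : holo_at f (x, y) ->
  (continuous (fun x => Re (f (x, y))) x /\ continuous (fun x => Im (f (x, y))) x) /\
  (continuous (fun y => Re (f (x, y))) y /\ continuous (fun y => Im (f (x, y))) y).
Proof.
  intros H; destruct (holo_at_closed_forms f x y H) as [H1 H2].
  apply closed_form_at_continuous in H1; apply closed_form_at_continuous in H2.
  split; (split; [first [apply H1|apply H2]|]); try apply H2.
  apply continuous_ext with (fun y => - - Im (f (x, y))); [intros; apply Ropp_involutive|].
  apply (continuous_opp (fun y => - Im (f (x, y)))); apply H1.
Qed.

Lemma continuous_bounded (f : R -> R) (a b : R) : a <= b ->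
  (forall x, a <= x <= b -> continuous f x) ->
  exists M, 0 <= M /\ forall x, a <= x <= b -> Rabs (f x) <= M.
Proof.
  intros Hab Hf.
  destruct (continuity_ab_maj (fun x => Rabs (f x)) a b Hab) as [z [Hz _]].
  - intros c Hc; apply continuity_pt_filterlim.
    apply (continuous_comp f Rabs); [now apply Hf|apply continuous_Rabs].
  - exists (Rabs (f z)); split; [apply Rabs_pos|exact Hz].
Qed.

(** If psi x0 > 0, then psi >= psi x0 / 2 on |x - x0| <= del. The inner half of that interval
    contributes at least a constant times exp (-n del^2 / 4), while negative contributions and the
    assumed bound are only of order exp (-n del^2). For large n this is impossible, and no
    normalisation of the Gaussian is required. *)
Lemma gaussian_localisation (psi : R -> R) (x0 T eta K : R) :
  0 < T -> 0 < eta -> (forall x, x0 - T <= x <= x0 + T -> continuous psi x) ->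
  (forall n : nat, Rabs (RInt (fun x => psi x * exp (- INR n * (x - x0) ^ 2)) (x0 - T) (x0 + T))
     <= K * exp (- INR n * eta)) ->
  psi x0 <= 0.
Proof.
  intros HT Heta Hc HI; apply Rnot_lt_le; intros Hpos.
  destruct (continuous_bounded psi (x0 - T) (x0 + T)) as [M [HM0 HM]]; [lra|exact Hc|].
  assert (Hc0 : continuity_pt psi x0) by (apply continuity_pt_filterlim, Hc; lra).
  destruct (Hc0 (psi x0 / 2)) as [al [Hal Hcont]]; [lra|].
  (* al / 2 keeps the closed interval inside the range of continuity, T keeps it inside the domain
     of integration, and 1 together with eta gives del^2 <= eta. *)
  set (del := Rmin (Rmin (al / 2) T) (Rmin 1 eta)).
  assert (Hd0 : 0 < del) by (unfold del; repeat apply Rmin_glb_lt; lra).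
  assert (Hd1 : del <= al / 2) by (unfold del; eapply Rle_trans; [apply Rmin_l|apply Rmin_l]).
  assert (Hd2 : del <= T) by (unfold del; eapply Rle_trans; [apply Rmin_l|apply Rmin_r]).
  assert (Hd3 : del <= 1) by (unfold del; eapply Rle_trans; [apply Rmin_r|apply Rmin_l]).
  assert (Hd4 : del <= eta) by (unfold del; eapply Rle_trans; [apply Rmin_r|apply Rmin_r]).
  assert (Hnear : forall x, Rabs (x - x0) <= del -> psi x0 / 2 <= psi x).
  { intros x Hx. destruct (Req_dec x x0) as [->|Hne]; [lra|].
    assert (Hd := Hcont x). unfold dist, D_x, no_cond in Hd; simpl in Hd; unfold Rdist in Hd.
    assert (Hlt : Rabs (x - x0) < al) by lra.
    specialize (Hd (conj (conj I (not_eq_sym Hne)) Hlt)). apply Rabs_def2 in Hd; lra. }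
  assert (Hmain : forall n : nat, del * (psi x0 / 2) * exp (- INR n * (del ^ 2 / 4))
     <= (2 * T * M + Rabs K) * exp (- INR n * del ^ 2)).
  { intros n; specialize (HI n).
    set (g := fun x => psi x * exp (- INR n * (x - x0) ^ 2)) in *.
    pose proof (pos_INR n) as Hn.
    assert (Hg : forall a b, x0 - T <= a -> a <= b -> b <= x0 + T -> ex_RInt g a b).
    { intros a b Ha Hab Hb; apply (ex_RInt_continuous (V := R_CompleteNormedModule)); intros x Hx.
      rewrite Rmin_left, Rmax_right in Hx by lra.
      apply (continuous_mult psi); [apply Hc; lra|].
      apply (ex_derive_continuous (V := R_NormedModule)); auto_derive; trivial. }
    assert (Hout : forall x, x0 - T <= x <= x0 + T -> - M * exp (- INR n * del ^ 2) <= g x).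
    { intros x Hx; unfold g. pose proof (exp_pos (- INR n * (x - x0) ^ 2)).
      pose proof (exp_pos (- INR n * del ^ 2)).
      destruct (Rle_dec (Rabs (x - x0)) del) as [Hin|Hin].
      - pose proof (Hnear x Hin). assert (0 <= psi x * exp (- INR n * (x - x0) ^ 2)) by nra. nra.
      - apply Rnot_le_lt in Hin. specialize (HM x Hx). apply Rabs_le_between in HM.
        assert (del ^ 2 <= (x - x0) ^ 2) by (rewrite <- (pow2_abs (x - x0)); apply pow_incr; lra).
        assert (exp (- INR n * (x - x0) ^ 2) <= exp (- INR n * del ^ 2)) by (apply exp_le; nra).
        nra. }
    assert (Hin : forall x, x0 - del / 2 <= x <= x0 + del / 2 ->
       psi x0 / 2 * exp (- INR n * (del ^ 2 / 4)) <= g x).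
    { intros x Hx; unfold g.
      assert (Ha : Rabs (x - x0) <= del / 2) by (apply Rabs_le; lra).
      pose proof (Hnear x ltac:(lra)).
      assert ((x - x0) ^ 2 <= del ^ 2 / 4).
      { rewrite <- (pow2_abs (x - x0)). replace (del ^ 2 / 4) with ((del / 2) ^ 2) by field.
        apply pow_incr; split; [apply Rabs_pos|lra]. }
      assert (exp (- INR n * (del ^ 2 / 4)) <= exp (- INR n * (x - x0) ^ 2)) by (apply exp_le; nra).
      pose proof (exp_pos (- INR n * (del ^ 2 / 4))).
      apply Rmult_le_compat; lra. }
    assert (Hlow : forall a b m, x0 - T <= a -> a <= b -> b <= x0 + T ->
      (forall x, a <= x <= b -> m <= g x) -> (b - a) * m <= RInt g a b).
    { intros a b m Ha Hab Hb Hm.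
      replace ((b - a) * m) with (RInt (fun _ => m) a b) by (rewrite RInt_const; reflexivity).
      apply RInt_le; [exact Hab|apply ex_RInt_const|now apply Hg|].
      intros; apply Hm; lra. }
    pose proof (Hlow (x0 - T) (x0 - del / 2) _ ltac:(lra) ltac:(lra) ltac:(lra)
       (fun x Hx => Hout x ltac:(lra))) as L1.
    pose proof (Hlow (x0 + del / 2) (x0 + T) _ ltac:(lra) ltac:(lra) ltac:(lra)
       (fun x Hx => Hout x ltac:(lra))) as L2.
    pose proof (Hlow (x0 - del / 2) (x0 + del / 2) _ ltac:(lra) ltac:(lra) ltac:(lra)
       (fun x Hx => Hin x Hx)) as L3.
    rewrite <- (RInt_Chasles g (x0 - T) (x0 - del / 2) (x0 + T)) in HI by (apply Hg; lra).
    rewrite <- (RInt_Chasles g (x0 - del / 2) (x0 + del / 2) (x0 + T)) in HI by (apply Hg; lra).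
    unfold plus in HI; simpl in HI.
    apply Rabs_le_between in HI.
    assert (He : exp (- INR n * eta) <= exp (- INR n * del ^ 2)).
    { apply exp_le. assert (del ^ 2 <= eta) by (simpl; nra). nra. }
    pose proof (exp_pos (- INR n * del ^ 2)); pose proof (exp_pos (- INR n * eta)).
    pose proof (Rle_abs K); pose proof (Rabs_pos K).
    set (E1 := exp (- INR n * del ^ 2)) in *.
    assert (K * exp (- INR n * eta) <= Rabs K * E1).
    { apply Rle_trans with (Rabs K * exp (- INR n * eta)).
      - apply Rmult_le_compat_r; lra.
      - apply Rmult_le_compat_l; lra. }
    assert (0 <= M * E1) by (apply Rmult_le_pos; lra).
    assert (0 <= del * (M * E1)) by (apply Rmult_le_pos; lra).
    nra. }
  set (A := del * (psi x0 / 2)) in *. set (B := 2 * T * M + Rabs K) in *.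
  assert (HA : 0 < A) by (unfold A; apply Rmult_lt_0_compat; lra).
  (* q is the gap between the two decay rates del^2 and del^2 / 4. After multiplication by exp (n
     del^2), the bound 1 + x <= exp x makes the left side grow linearly in n. *)
  set (q := 3 / 4 * del ^ 2). assert (Hq : 0 < q) by (unfold q; pose proof (pow_lt del 2 Hd0); lra).
  destruct (INR_unbounded (B / (A * q))) as [n Hn].
  specialize (Hmain n). pose proof (pos_INR n).
  assert (Hlin : A * (1 + INR n * q) <= B).
  { apply Rmult_le_compat_r with (r := exp (INR n * del ^ 2)) in Hmain; [|left; apply exp_pos].
    rewrite !Rmult_assoc, <- !exp_plus in Hmain.
    replace (- INR n * (del ^ 2 / 4) + INR n * del ^ 2) with (INR n * q) in Hmain by (unfold q; field).
    replace (- INR n * del ^ 2 + INR n * del ^ 2) with 0 in Hmain by ring.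
    rewrite exp_0, Rmult_1_r in Hmain.
    apply Rle_trans with (2 := Hmain). apply Rmult_le_compat_l; [lra|]. apply exp_ineq1_le. }
  apply Rmult_lt_compat_r with (r := A * q) in Hn; [|now apply Rmult_lt_0_compat].
  unfold Rdiv in Hn; rewrite Rmult_assoc, Rinv_l, Rmult_1_r in Hn by (apply Rgt_not_eq, Rmult_lt_0_compat; lra).
  nra.
Qed.

Lemma gaussian_localisation_eq (psi : R -> R) (x0 T eta K : R) :
  0 < T -> 0 < eta -> (forall x, x0 - T <= x <= x0 + T -> continuous psi x) ->
  (forall n : nat, Rabs (RInt (fun x => psi x * exp (- INR n * (x - x0) ^ 2)) (x0 - T) (x0 + T))
     <= K * exp (- INR n * eta)) ->
  psi x0 = 0.
Proof.
  intros HT He Hc HI. apply Rle_antisym; [now apply gaussian_localisation with T eta K|].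
  enough (- psi x0 <= 0) by lra.
  apply (gaussian_localisation (fun x => - psi x) x0 T eta K); auto.
  - intros; apply (continuous_opp psi); auto.
  - intros n.
    set (g := fun x => psi x * exp (- INR n * (x - x0) ^ 2)).
    assert (Hneg : is_RInt (fun x => - psi x * exp (- INR n * (x - x0) ^ 2)) (x0 - T) (x0 + T)
      (- RInt g (x0 - T) (x0 + T))).
    { apply (is_RInt_ext (V := R_NormedModule) (fun x => opp (g x))).
      - intros; unfold g, opp; simpl; ring.
      - apply (is_RInt_opp (V := R_NormedModule)), (RInt_correct (V := R_CompleteNormedModule)).
        apply (ex_RInt_continuous (V := R_CompleteNormedModule)); intros x Hx.
        rewrite Rmin_left, Rmax_right in Hx by lra.
        apply (continuous_mult psi); [apply Hc; lra|].
        apply (ex_derive_continuous (V := R_NormedModule)); auto_derive; trivial. }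
    rewrite (is_RInt_unique _ _ _ _ Hneg), Rabs_Ropp. apply HI.
Qed.

Lemma cpair_sub_sq (x y x0 y0 : R) :
  (((x, y) - (x0, y0)) * ((x, y) - (x0, y0)))%C
  = ((x - x0) ^ 2 - (y - y0) ^ 2, 2 * (x - x0) * (y - y0)).
Proof. unfold Cminus, Cplus, Copp, Cmult; simpl; f_equal; ring. Qed.

(** On the vertical sides the kernel has modulus exp (-n (T^2 - (y - y0)^2)), at most exp (-n (T^2 -
    y0^2)). This decays precisely because the half-width T exceeds the height y0. On the top side
    the kernel is a real Gaussian, so real and imaginary parts can be localised separately. *)
Lemma rectangle_vanishing (phi : C -> C) (x0 y0 T : R) : 0 <= y0 < T ->
  (forall x y, x0 - T <= x <= x0 + T -> 0 <= y <= y0 -> holo_at phi (x, y)) ->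
  (forall x, x0 - T <= x <= x0 + T -> phi (x, 0) = RtoC 0) ->
  phi (x0, y0) = RtoC 0.
Proof.
  intros Hy0 Hhol Hzero.
  set (k := fun (n : nat) (w : C) =>
     cexp (RtoC (- INR n) * ((w - (x0, y0)) * (w - (x0, y0))))%C).
  set (g := fun n w => (phi w * k n w)%C).
  assert (Hkhol : forall n w, holo_at (k n) w).
  { intros n w; unfold k. apply (holo_at_comp cexp); [apply holo_at_cexp|].
    apply holo_at_mult; [apply holo_at_const|].
    apply holo_at_mult; apply holo_at_minus; (apply holo_at_id || apply holo_at_const). }
  assert (Hghol : forall n x y, x0 - T <= x <= x0 + T -> 0 <= y <= y0 -> holo_at (g n) (x, y)).
  { intros; apply holo_at_mult; auto. }
  assert (Hgbot : forall n x, x0 - T <= x <= x0 + T -> g n (x, 0) = RtoC 0).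
  { intros n x Hx; unfold g; rewrite Hzero by exact Hx; apply Cmult_0_l. }
  assert (Hktop : forall n x, k n (x, y0) = RtoC (exp (- INR n * (x - x0) ^ 2))).
  { intros n x; unfold k; rewrite cpair_sub_sq. rewrite Rminus_diag.
    replace ((x - x0) ^ 2 - 0 ^ 2, 2 * (x - x0) * 0) with (RtoC ((x - x0) ^ 2))
      by (unfold RtoC; f_equal; ring).
    rewrite <- RtoC_mult, cexp_RtoC. reflexivity. }
  set (eta := T ^ 2 - y0 ^ 2).
  assert (Heta : 0 < eta) by (unfold eta; simpl; nra).
  assert (Hkside : forall n x y, Rabs (x - x0) = T -> 0 <= y <= y0 ->
     Cmod (k n (x, y)) <= exp (- INR n * eta)).
  { intros n x y Hx Hy; unfold k; rewrite Cmod_cexp, cpair_sub_sq, re_scal_l.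
    unfold Re, fst. rewrite <- (pow2_abs (x - x0)), Hx.
    assert (Hle : - INR n * (T ^ 2 - (y - y0) ^ 2) <= - INR n * eta).
    { unfold eta. assert ((y - y0) ^ 2 <= y0 ^ 2) by (simpl; nra). pose proof (pos_INR n); nra. }
    now apply exp_le. }
  assert (Hbound : forall x, x0 - T <= x <= x0 + T -> exists M, 0 <= M /\
     forall y, 0 <= y <= y0 -> Cmod (phi (x, y)) <= M).
  { intros x Hx.
    destruct (continuous_bounded (fun y => Re (phi (x, y))) 0 y0) as [M1 [P1 HM1]]; [lra| |].
    { intros y Hy; apply (holo_at_continuous_lines phi); apply Hhol; lra. }
    destruct (continuous_bounded (fun y => Im (phi (x, y))) 0 y0) as [M2 [P2 HM2]]; [lra| |].
    { intros y Hy; apply (holo_at_continuous_lines phi); apply Hhol; lra. }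
    exists (M1 + M2); split; [lra|]; intros y Hy.
    apply Rle_trans with (1 := Cmod_le_sum _); specialize (HM1 y Hy); specialize (HM2 y Hy); lra. }
  destruct (Hbound (x0 - T)) as [Ma [Pa HMa]]; [lra|].
  destruct (Hbound (x0 + T)) as [Mb [Pb HMb]]; [lra|].
  set (K := y0 * (Ma + Mb)).
  assert (Hside : forall n x M, (x = x0 - T \/ x = x0 + T) ->
     (forall y, 0 <= y <= y0 -> Cmod (phi (x, y)) <= M) -> 0 <= M ->
     forall p : R -> R, (forall y, 0 <= y <= y0 -> continuous p y) ->
     (forall y, Rabs (p y) <= Cmod (g n (x, y))) ->
     Rabs (RInt p 0 y0) <= y0 * M * exp (- INR n * eta)).
  { intros n x M Hx HM PM p Hpc Hp.
    replace (y0 * M * exp (- INR n * eta)) with ((y0 - 0) * (M * exp (- INR n * eta))) by ring.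
    apply (norm_RInt_le_const (V := R_NormedModule) p 0 y0); [lra| |].
    - intros y Hy. apply Rle_trans with (1 := Hp y). unfold g; rewrite Cmod_mult.
      apply Rmult_le_compat; [apply Cmod_ge_0|apply Cmod_ge_0|now apply HM|].
      apply Hkside; [|exact Hy].
      destruct Hx as [-> | ->]; [replace (x0 - T - x0) with (- T) by ring; rewrite Rabs_Ropp|
        replace (x0 + T - x0) with T by ring]; apply Rabs_pos_eq; lra.
    - apply (RInt_correct (V := R_CompleteNormedModule)).
      apply (ex_RInt_continuous (V := R_CompleteNormedModule)); intros y Hy.
      rewrite Rmin_left, Rmax_right in Hy by lra; now apply Hpc. }
  (* Used with (p, q) = (Re, -Im) and (Im, Re), the two real forms of g dz. *)
  assert (Hgen : forall (p q : C -> R) n,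
    (p (RtoC 0) = 0) -> (forall z, Rabs (q z) <= Cmod z) ->
    (forall x y, x0 - T <= x <= x0 + T -> 0 <= y <= y0 ->
       closed_form_at (fun x y => p (g n (x, y))) (fun x y => q (g n (x, y))) x y) ->
    Rabs (RInt (fun x => p (g n (x, y0))) (x0 - T) (x0 + T)) <= K * exp (- INR n * eta)).
  { intros p q n Hp0 Hq Hcf.
    pose proof (loop_integral_eq_0 _ _ (x0 - T) (x0 + T) 0 y0 Hcf ltac:(lra) ltac:(lra)) as HL.
    unfold loop_integral in HL.
    rewrite (RInt_ext (fun x => p (g n (x, 0))) (fun _ => 0)) in HL.
    2:{ intros x Hx; rewrite Rmin_left, Rmax_right in Hx by lra. rewrite Hgbot by lra. exact Hp0. }
    rewrite RInt_const in HL. unfold scal in HL; simpl in HL; unfold mult in HL; simpl in HL.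
    assert (S1 := Hside n (x0 + T) Mb (or_intror eq_refl) HMb Pb (fun y => q (g n (x0 + T, y)))
      (fun y Hy => proj2 (closed_form_at_continuous _ _ _ _ (Hcf (x0 + T) y ltac:(lra) Hy)))
      (fun y => Hq _)).
    assert (S2 := Hside n (x0 - T) Ma (or_introl eq_refl) HMa Pa (fun y => q (g n (x0 - T, y)))
      (fun y Hy => proj2 (closed_form_at_continuous _ _ _ _ (Hcf (x0 - T) y ltac:(lra) Hy)))
      (fun y => Hq _)).
    apply Rabs_le_between in S1, S2. apply Rabs_le. unfold K. nra. }
  assert (HR : Re (phi (x0, y0)) = 0).
  { apply (gaussian_localisation_eq (fun x => Re (phi (x, y0))) x0 T eta K); [lra|exact Heta| |].
    - intros x Hx; apply (holo_at_continuous_lines phi); apply Hhol; lra.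
    - intros n. rewrite (RInt_ext _ (fun x => Re (g n (x, y0)))).
      + apply (Hgen Re (fun z => - Im z)).
        * apply re_RtoC.
        * intros z; rewrite Rabs_Ropp; apply im_le_Cmod.
        * intros x y Hx Hy; apply (holo_at_closed_forms (g n)); now apply Hghol.
      + intros x _; unfold g; rewrite Hktop, re_scal_r; reflexivity. }
  assert (HI : Im (phi (x0, y0)) = 0).
  { apply (gaussian_localisation_eq (fun x => Im (phi (x, y0))) x0 T eta K); [lra|exact Heta| |].
    - intros x Hx; apply (holo_at_continuous_lines phi); apply Hhol; lra.
    - intros n. rewrite (RInt_ext _ (fun x => Im (g n (x, y0)))).
      + apply (Hgen Im Re).
        * apply im_RtoC.
        * apply re_le_Cmod.
        * intros x y Hx Hy; apply (holo_at_closed_forms (g n)); now apply Hghol.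
      + intros x _; unfold g; rewrite Hktop, im_scal_r; reflexivity. }
  destruct (phi (x0, y0)) as [a b]; unfold Re, Im in *; simpl in *; subst; reflexivity.
Qed.

(** The argument is taken in [0, 2 PI], not around 0, because [rectangle_vanishing] works upwards
    from the real axis. *)
Lemma polar_form (z : C) : z <> RtoC 0 ->
  exists t, 0 <= t <= 2 * PI /\ z = cexp (ln (Cmod z), t).
Proof.
  intros Hz; pose proof (proj1 (Cmod_gt_0 z) Hz) as Hp.
  set (r := Cmod z) in *.
  assert (Hr2 : r ^ 2 = Re z ^ 2 + Im z ^ 2) by apply Cmod2_alt.
  assert (Hc : -1 <= Re z / r <= 1).
  { apply Rabs_le_between. unfold Rdiv; rewrite Rabs_mult, (Rabs_pos_eq (/ r))
      by (left; now apply Rinv_0_lt_compat).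
    apply Rmult_le_reg_r with r; [lra|]. rewrite Rmult_assoc, Rinv_l, Rmult_1_l, Rmult_1_r by lra.
    apply re_le_Cmod. }
  assert (Hs : r * sqrt (1 - (Re z / r) ^ 2) = Rabs (Im z)).
  { rewrite <- (sqrt_pow2 r) at 1 by lra. rewrite <- sqrt_mult_alt by (apply pow2_ge_0).
    replace (r ^ 2 * (1 - (Re z / r) ^ 2)) with (Im z ^ 2).
    - now rewrite <- pow2_abs, sqrt_pow2 by apply Rabs_pos.
    - replace (r ^ 2 * (1 - (Re z / r) ^ 2)) with (r ^ 2 - Re z ^ 2) by (field; lra). lra. }
  pose proof (acos_bound (Re z / r)).
  assert (Hcexp : forall t, cexp (ln r, t) = (r * cos t, r * sin t)).
  { intros t; unfold cexp, Re, Im; simpl; now rewrite exp_ln. }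
  destruct (Rle_dec 0 (Im z)) as [Hi|Hi].
  - exists (acos (Re z / r)); split; [lra|].
    rewrite Hcexp, cos_acos, sin_acos, Rsqr_pow2, Hs, Rabs_pos_eq by lra.
    destruct z as [a b]; unfold Re, Im in *; simpl in *; f_equal; field; lra.
  - exists (- acos (Re z / r) + 2 * INR 1 * PI); split; [simpl; lra|].
    rewrite Hcexp, cos_period, sin_period, cos_neg, sin_neg, cos_acos, sin_acos, Rsqr_pow2 by lra.
    replace (r * - sqrt (1 - (Re z / r) ^ 2)) with (- Rabs (Im z)) by (rewrite <- Hs; ring).
    rewrite Rabs_left by lra.
    destruct z as [a b]; unfold Re, Im in *; simpl in *; f_equal; field; lra.
Qed.

(* With [s = a + exp w] the punctured disc unrolls to a half plane, where the rectangle argument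
   applies with its bottom side on the real axis. *)
Theorem punctured_disc_vanishing (f : C -> C) (a : C) (Rad : R) : 0 < Rad ->
  (forall s, 0 < Cmod (s - a)%C < Rad -> holo_at f s) ->
  (forall r : R, 0 < r < Rad -> f (a + RtoC r)%C = RtoC 0) ->
  forall s, 0 < Cmod (s - a)%C < Rad * exp (- 9) -> f s = RtoC 0.
Proof.
  intros HR Hhol Hzero s [Hs1 Hs2].
  assert (Hne : (s - a)%C <> RtoC 0) by now apply Cmod_gt_0.
  destruct (polar_form _ Hne) as [t [Ht Hst]].
  set (rho := Cmod (s - a)%C) in *.
  assert (Hx : forall x, x <= ln rho + 9 -> exp x < Rad).
  { intros x Hx. apply Rle_lt_trans with (exp (ln rho + 9)).
    - now apply exp_le.
    - rewrite exp_plus, exp_ln by lra.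
      apply Rmult_lt_compat_r with (r := exp 9) in Hs2; [|apply exp_pos].
      rewrite Rmult_assoc, <- exp_plus in Hs2. replace (-9 + 9) with 0 in Hs2 by ring.
      rewrite exp_0, Rmult_1_r in Hs2. exact Hs2. }
  replace s with (a + cexp (ln rho, t))%C by (rewrite <- Hst; ring).
  pose proof PI_4.
  (* Since PI <= 4, the height t is at most 8, so half-width 9 suffices. The rectangle then reaches
     radius rho * exp 9, which is still below [Rad]. *)
  apply (rectangle_vanishing (fun w => f (a + cexp w)%C) (ln rho) t 9); [lra| |].
  - intros x y Hxx Hy.
    apply (holo_at_comp f (fun w => a + cexp w)%C).
    + apply Hhol. replace (a + cexp (x, y) - a)%C with (cexp (x, y)) by ring.
      rewrite Cmod_cexp; unfold Re; simpl. split; [apply exp_pos|apply Hx; lra].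
    + apply holo_at_plus; [apply holo_at_const|apply holo_at_cexp].
  - intros x Hxx. change (x, 0) with (RtoC x). rewrite cexp_RtoC.
    apply Hzero; split; [apply exp_pos|apply Hx; lra].
Qed.

(** * Bernoulli numbers *)

(** Course-of-values recursion: level n tabulates the values up to n, so that the next one can refer
    to all of them. The recurrence expresses that (exp t - 1) / t times the sum of [bern i] t^i
    equals 1. *)
Fixpoint bern_table (n : nat) : nat -> R :=
  match n with
  | O => fun _ => 1
  | S m => fun j => if (j <=? m)%nat then bern_table m j
      else - sum_f_R0 (fun i => bern_table m i / INR (fact (m + 2 - i))) m
  end.

(* [bern j] is B_j / j! with the convention B_1 = -1/2, and [bern_poly k] is B_k(x) / k!. *)
Definition bern (n : nat) : R := bern_table n n.

Definition bern_poly (k : nat) (x : R) : R :=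
  sum_f_R0 (fun i => bern (k - i) * x ^ i / INR (fact i)) k.

Lemma bern_table_stable (n j : nat) : (j <= n)%nat -> bern_table n j = bern j.
Proof.
  intros H; induction n as [|n IH].
  - now replace j with 0%nat by lia.
  - destruct (Nat.eq_dec j (S n)) as [->|Hne]; [reflexivity|].
    simpl. replace (j <=? n)%nat with true by (symmetry; apply Nat.leb_le; lia).
    apply IH; lia.
Qed.

Lemma bern_S (m : nat) :
  bern (S m) = - sum_f_R0 (fun i => bern i / INR (fact (m + 2 - i))) m.
Proof.
  change (bern (S m)) with (if (S m <=? m)%nat then bern_table m (S m)
    else - sum_f_R0 (fun i => bern_table m i / INR (fact (m + 2 - i))) m).
  replace (S m <=? m)%nat with false by (symmetry; apply Nat.leb_gt; lia).
  f_equal; apply sum_eq; intros i Hi; now rewrite bern_table_stable.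
Qed.

Lemma bern_0 : bern 0 = 1.
Proof. reflexivity. Qed.

Lemma bern_1 : bern 1 = - (1 / 2).
Proof. rewrite bern_S; simpl; rewrite bern_0; field. Qed.

Lemma INR_fact_S (n : nat) : INR (fact (S n)) = (INR n + 1) * INR (fact n).
Proof. rewrite fact_simpl, mult_INR, S_INR; reflexivity. Qed.

Lemma sum_f_R0_flip (f : nat -> R) (n : nat) :
  sum_f_R0 f n = sum_f_R0 (fun i => f (n - i)%nat) n.
Proof.
  induction n as [|n IH]; [reflexivity|].
  rewrite (decomp_sum (fun i => f (S n - i)%nat)) by lia.
  rewrite tech5, IH, Nat.sub_0_r. simpl pred. rewrite Rplus_comm; reflexivity.
Qed.

Lemma bern_poly_0 (k : nat) : bern_poly k 0 = bern k.
Proof.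
  unfold bern_poly; destruct k as [|k]; [simpl; field|].
  rewrite decomp_sum by lia. rewrite Nat.sub_0_r.
  rewrite (sum_eq _ (fun _ => 0)).
  - rewrite sum_cte; simpl; field.
  - intros i _. simpl. unfold Rdiv; ring.
Qed.

Lemma is_derive_divided_power (c : R) (i : nat) (x : R) :
  is_derive (fun x => c * x ^ S i / INR (fact (S i))) x (c * x ^ i / INR (fact i)).
Proof.
  pose proof (INR_fact_neq_0 i); pose proof (pos_INR i).
  assert (E : forall t : R, (c / INR (fact (S i))) * t ^ S i = c * t ^ S i / INR (fact (S i)))
    by (intros t; unfold Rdiv; ring).
  evar_last.
  - apply (is_derive_ext _ _ _ _ E).
    apply is_derive_scal, is_derive_pow, is_derive_id.
  - rewrite INR_fact_S, S_INR. unfold one; simpl. field. split; [assumption|lra].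
Qed.

(** Division of everything by factorials makes differentiation lower the index with no extra
    factor. *)
Lemma is_derive_bern_poly (k : nat) (x : R) :
  is_derive (bern_poly (S k)) x (bern_poly k x).
Proof.
  unfold bern_poly.
  apply (is_derive_ext (fun x => bern (S k) + sum_f_R0 (fun i => bern (k - i) * x ^ S i / INR (fact (S i))) k)).
  { intros t. rewrite (decomp_sum _ (S k)) by lia. rewrite Nat.sub_0_r; simpl pred.
    f_equal. simpl; field. }
  evar_last.
  apply (is_derive_plus (V := R_NormedModule)); [apply is_derive_const|].
  2:{ unfold plus, zero; simpl. apply Rplus_0_l. }
  assert (H : forall n, (n <= k)%nat -> is_derive
     (fun x => sum_f_R0 (fun i => bern (k - i) * x ^ S i / INR (fact (S i))) n) x
     (sum_f_R0 (fun i => bern (k - i) * x ^ i / INR (fact i)) n)); [|now apply H].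
  assert (Hterm : forall i, is_derive (fun x => bern (k - i) * x ^ S i / INR (fact (S i))) x
     (bern (k - i) * x ^ i / INR (fact i))).
  { intros i; apply is_derive_divided_power. }
  induction n as [|n IH]; intros Hn; [apply Hterm|].
  rewrite tech5.
  apply (is_derive_plus (V := R_NormedModule)); [apply IH; lia|apply Hterm].
Qed.

Lemma continuous_bern_poly (k : nat) (x : R) : continuous (bern_poly k) x.
Proof.
  destruct k as [|k].
  - apply continuous_ext with (fun _ => 1); [|apply continuous_const].
    intros t; unfold bern_poly; simpl; rewrite bern_0; simpl; field.
  - apply (ex_derive_continuous (V := R_NormedModule)); eexists; apply is_derive_bern_poly.
Qed.

Lemma bern_poly_0_l (x : R) : bern_poly 0 x = 1.
Proof. unfold bern_poly; simpl; rewrite bern_0; field. Qed.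

Lemma bern_poly_1_l (x : R) : bern_poly 1 x = x - 1 / 2.
Proof. unfold bern_poly; simpl; rewrite bern_0, bern_1; field. Qed.

(** All terms of B_k(1) / k! except [bern k] sum to zero, by the recurrence that defines the
    Bernoulli numbers. *)
Lemma bern_poly_1_eq (k : nat) : (2 <= k)%nat -> bern_poly k 1 = bern k.
Proof.
  intros Hk; destruct k as [|[|m]]; [lia|lia|].
  unfold bern_poly. rewrite decomp_sum by lia. rewrite Nat.sub_0_r; simpl pred.
  rewrite sum_f_R0_flip.
  rewrite (sum_eq _ (fun i => bern i / INR (fact (m + 2 - i)))).
  - rewrite tech5. replace (m + 2 - S m)%nat with 1%nat by lia.
    rewrite (bern_S m). simpl fact; simpl INR; simpl pow. field.
  - intros i Hi. replace (S (S m) - S (S m - i))%nat with i by lia.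
    replace (S (S m - i)) with (m + 2 - i)%nat by lia. rewrite pow1. now rewrite Rmult_1_r.
Qed.

Lemma eq_of_is_derive_0 (f : R -> R) : (forall x, is_derive f x 0) -> forall x, f x = f 0.
Proof.
  intros H x. destruct (MVT_gen f 0 x (fun _ => 0)) as [c [_ Hc]].
  - intros; apply H.
  - intros; apply continuity_pt_filterlim. apply (ex_derive_continuous (V := R_NormedModule)); eexists; apply H.
  - lra.
Qed.

(** Both sides have the same derivative by induction and the same value at 0, there by
    [bern_poly_1_eq]. *)
Lemma bern_poly_shift (k : nat) (x : R) :
  bern_poly (S k) (x + 1) - bern_poly (S k) x = x ^ k / INR (fact k).
Proof.
  revert x; induction k as [|k IH]; intros x.
  - rewrite !bern_poly_1_l; simpl; field.
  - set (f := fun x => bern_poly (S (S k)) (x + 1) - bern_poly (S (S k)) x - x ^ S k / INR (fact (S k))).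
    enough (f x = 0) by (unfold f in *; lra).
    rewrite (eq_of_is_derive_0 f).
    + unfold f. rewrite Rplus_0_l, bern_poly_1_eq, bern_poly_0 by lia. simpl pow; unfold Rdiv; ring.
    + intros t. unfold f.
      evar_last.
      apply (is_derive_minus (V := R_NormedModule)).
      apply (is_derive_minus (V := R_NormedModule)).
      * apply (is_derive_comp (bern_poly (S (S k))) (fun x => x + 1)); [apply is_derive_bern_poly|].
        auto_derive; [trivial|reflexivity].
      * apply is_derive_bern_poly.
      * apply (is_derive_ext (fun t => 1 * t ^ S k / INR (fact (S k)))); [|apply is_derive_divided_power].
        intros; now rewrite Rmult_1_l.
      * unfold minus, plus, opp, scal; simpl; unfold mult; simpl. rewrite (Rmult_1_l (t ^ k)), <- (IH t). ring.
Qed.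

Lemma is_derive_bern_reflect (k : nat) (x : R) :
  is_derive (fun x => bern_poly (S k) (1 - x) - (-1) ^ S k * bern_poly (S k) x) x
   (- (bern_poly k (1 - x) - (-1) ^ k * bern_poly k x)).
Proof.
  evar_last.
  apply (is_derive_minus (V := R_NormedModule)).
  - apply (is_derive_comp (bern_poly (S k)) (fun x => 1 - x)); [apply is_derive_bern_poly|].
    auto_derive; [trivial|reflexivity].
  - apply is_derive_scal, is_derive_bern_poly.
  - unfold minus, plus, opp, scal; simpl; unfold mult; simpl. ring.
Qed.

(** By induction the defect [q] of degree k + 2 has zero derivative, hence is constant. The constant
    is found one degree higher: there the defect has minus this constant as its derivative and takes
    equal values at 0 and 1. *)
Lemma bern_poly_reflect (k : nat) (x : R) : bern_poly k (1 - x) = (-1) ^ k * bern_poly k x.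
Proof.
  revert x.
  assert (H : forall k, (forall x, bern_poly k (1 - x) - (-1) ^ k * bern_poly k x = 0)).
  2:{ intros x; specialize (H k x); lra. }
  clear k; induction k as [|k IH]; intros x.
  - rewrite !bern_poly_0_l; simpl; ring.
  - destruct k as [|k]; [rewrite !bern_poly_1_l; simpl; field|].
    set (q j x := bern_poly j (1 - x) - (-1) ^ j * bern_poly j x) in *.
    assert (Hconst : forall x, q (S (S k)) x = q (S (S k)) 0).
    { apply eq_of_is_derive_0; intros t.
      replace 0 with (- (q (S k) t)) by (unfold q; rewrite IH; ring). apply is_derive_bern_reflect. }
    assert (Hder : forall x, is_derive (q (S (S (S k)))) x (- q (S (S k)) 0)).
    { intros t; rewrite <- (Hconst t). apply is_derive_bern_reflect. }
    change (q (S (S k)) x = 0).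
    rewrite Hconst.
    destruct (MVT_gen (q (S (S (S k)))) 0 1 (fun _ => - q (S (S k)) 0)) as [c [_ Hc]].
    + intros; apply Hder.
    + intros; apply continuity_pt_filterlim. apply (ex_derive_continuous (V := R_NormedModule)); eexists; apply Hder.
    + unfold q at 1 2 in Hc. rewrite !Rminus_diag, !Rminus_0_r in Hc.
      rewrite !bern_poly_0, !bern_poly_1_eq in Hc by lia. lra.
Qed.

Lemma bern_odd (k : nat) : bern (2 * k + 3) = 0.
Proof.
  pose proof (bern_poly_reflect (2 * k + 3) 0) as H.
  rewrite Rminus_0_r, bern_poly_0, bern_poly_1_eq in H by lia.
  replace (2 * k + 3)%nat with (S (2 * (S k)))%nat in * by lia.
  rewrite pow_1_odd in H. lra.
Qed.

Lemma bern_poly_odd_half (k : nat) : bern_poly (2 * k + 1) (1 / 2) = 0.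
Proof.
  pose proof (bern_poly_reflect (2 * k + 1) (1 / 2)) as H.
  replace (1 - 1 / 2) with (1 / 2) in H by field.
  replace (2 * k + 1)%nat with (S (2 * k)) in * by lia.
  rewrite pow_1_odd in H. lra.
Qed.

Lemma MVT_bern_poly (k : nat) (a b : R) : a < b ->
  exists c, a < c < b /\ bern_poly (S k) b - bern_poly (S k) a = bern_poly k c * (b - a).
Proof.
  intros Hab.
  destruct (MVT_cor2 (bern_poly (S k)) (bern_poly k) a b Hab) as [c [Hc1 Hc2]].
  - intros c _. apply is_derive_Reals, is_derive_bern_poly.
  - exists c; split; [exact Hc2|exact Hc1].
Qed.

(* [bern_poly (2k+3)] vanishes at 0 and 1/2 and has second derivative [bern_poly (2k+1)], so the
   sign of one determines that of the other by convexity. *)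
Lemma bern_poly_odd_sign (k : nat) (x : R) : 0 < x < 1 / 2 ->
  (-1) ^ S k * bern_poly (2 * k + 1) x > 0.
Proof.
  revert x; induction k as [|k IH]; intros x Hx.
  - simpl; rewrite bern_poly_1_l; lra.
  - assert (E0 : bern_poly (2 * S k + 1) 0 = 0).
    { rewrite bern_poly_0. replace (2 * S k + 1)%nat with (2 * k + 3)%nat by lia. apply bern_odd. }
    pose proof (bern_poly_odd_half (S k)) as E1.
    replace (2 * S k + 1)%nat with (S (S (2 * k + 1))) in * by lia.
    destruct (MVT_bern_poly (S (2 * k + 1)) 0 x) as [c1 [Hc1 Hm1]]; [lra|].
    destruct (MVT_bern_poly (S (2 * k + 1)) x (1 / 2)) as [c2 [Hc2 Hm2]]; [lra|].
    destruct (MVT_bern_poly (2 * k + 1) c1 c2) as [c3 [Hc3 Hm3]]; [lra|].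
    specialize (IH c3 ltac:(lra)).
    rewrite E0 in Hm1. rewrite E1 in Hm2.
    set (P := bern_poly (S (S (2 * k + 1))) x) in *.
    set (q1 := bern_poly (S (2 * k + 1)) c1) in *. set (q2 := bern_poly (S (2 * k + 1)) c2) in *.
    set (r := bern_poly (2 * k + 1) c3) in *.
    change ((-1) ^ S (S k)) with (-1 * (-1) ^ S k). set (e := (-1) ^ S k) in *.
    apply Rnot_le_gt; intros Hle.
    assert (e * q1 >= 0) by (assert (0 <= (e * q1) * x) by nra; nra).
    assert (e * q2 <= 0) by (assert ((e * q2) * (1 / 2 - x) <= 0) by nra; nra).
    assert (0 < (e * r) * (c2 - c1)) by (apply Rmult_lt_0_compat; lra).
    nra.
Qed.

(** The polynomial of index 2k + 3 vanishes at 0 and 1/2, so the one of index 2k + 2 has a zero c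
    between them. If it vanished at 0 too, the one of index 2k + 1 would have a zero in (0, c),
    against [bern_poly_odd_sign]. *)
Lemma bern_even_neq_0 (k : nat) : bern (2 * k + 2) <> 0.
Proof.
  intros E.
  destruct (MVT_bern_poly (2 * k + 2) 0 (1 / 2)) as [c [Hc Hm]]; [lra|].
  replace (S (2 * k + 2)) with (2 * k + 3)%nat in Hm by lia.
  rewrite bern_poly_0, bern_odd in Hm.
  replace (2 * k + 3)%nat with (2 * S k + 1)%nat in Hm by lia.
  rewrite bern_poly_odd_half in Hm.
  destruct (MVT_bern_poly (2 * k + 1) 0 c) as [c' [Hc' Hm']]; [lra|].
  replace (S (2 * k + 1)) with (2 * k + 2)%nat in Hm' by lia.
  rewrite bern_poly_0, E in Hm'.
  pose proof (bern_poly_odd_sign k c' ltac:(lra)) as Hs.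
  assert (bern_poly (2 * k + 2) c = 0) as E2 by nra. rewrite E2 in Hm'.
  assert (bern_poly (2 * k + 1) c' = 0) as E3 by nra. rewrite E3 in Hs. lra.
Qed.

(** [bern_poly_shift] telescopes. The sum starts at 0, and [pow] gives 0^0 = 1, so n = 0 is covered
    as well. *)
Lemma faulhaber (n N : nat) :
  sum_f_R0 (fun m => INR m ^ n) N =
  INR (fact n) * (bern_poly (S n) (INR N + 1) - bern (S n)).
Proof.
  pose proof (INR_fact_neq_0 n) as Hf.
  assert (Hstep : forall x, x ^ n = INR (fact n) * (bern_poly (S n) (x + 1) - bern_poly (S n) x)).
  { intros x; rewrite bern_poly_shift; field; exact Hf. }
  induction N as [|N IH].
  - simpl sum_f_R0. simpl INR. rewrite Hstep, bern_poly_0. reflexivity.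
  - rewrite tech5, IH, Hstep, S_INR. ring.
Qed.

(** * Euler-Maclaurin continuation of zeta *)

Lemma Re_sum_n (u : nat -> C) (n : nat) :
  Re (sum_n (G := C_NormedModule) u n) = sum_n (fun k => Re (u k)) n.
Proof.
  induction n as [|n IH]; [now rewrite !sum_O|].
  rewrite !sum_Sn, <- IH. reflexivity.
Qed.

Lemma Im_sum_n (u : nat -> C) (n : nat) :
  Im (sum_n (G := C_NormedModule) u n) = sum_n (fun k => Im (u k)) n.
Proof.
  induction n as [|n IH]; [now rewrite !sum_O|].
  rewrite !sum_Sn, <- IH. reflexivity.
Qed.

Lemma is_series_C_iff (u : nat -> C) (l : C) :
  @is_series C_AbsRing C_NormedModule u l <->
  is_series (fun k => Re (u k)) (Re l) /\ is_series (fun k => Im (u k)) (Im l).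
Proof.
  split.
  - intros H.
    pose proof (proj1 (filterlim_locally (U := C_UniformSpace) _ l) H) as H'.
    split; apply (filterlim_locally (U := R_UniformSpace)); intros eps; specialize (H' eps);
      (revert H'; apply filter_imp; intros n [H1 H2]).
    + rewrite <- Re_sum_n; exact H1.
    + rewrite <- Im_sum_n; exact H2.
  - intros [H1 H2]. apply (filterlim_locally (U := C_UniformSpace)); intros eps.
    pose proof (proj1 (filterlim_locally (U := R_UniformSpace) _ _) H1 eps) as K1.
    pose proof (proj1 (filterlim_locally (U := R_UniformSpace) _ _) H2 eps) as K2.
    generalize (filter_and _ _ K1 K2); apply filter_imp; intros n [L1 L2].
    rewrite <- Re_sum_n in L1; rewrite <- Im_sum_n in L2. split; assumption.
Qed.

(** [Series] is total, so this is a function of any parameter in [u] before convergence is known. *)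
Definition csum (u : nat -> C) : C := (Series (fun k => Re (u k)), Series (fun k => Im (u k))).

Lemma ex_series_component (u : nat -> C) (a : nat -> R) (p : C -> R) :
  (forall z, Rabs (p z) <= Cmod z) -> (forall k, Cmod (u k) <= a k) -> ex_series a ->
  ex_series (fun k => p (u k)).
Proof.
  intros Hp Hu Ha; apply (ex_series_le (V := R_CompleteNormedModule) _ a); [|exact Ha].
  intros n; apply Rle_trans with (2 := Hu n), Hp.
Qed.

Lemma is_series_csum (u : nat -> C) (a : nat -> R) :
  (forall k, Cmod (u k) <= a k) -> ex_series a ->
  @is_series C_AbsRing C_NormedModule u (csum u).
Proof.
  intros Hu Ha; apply is_series_C_iff; split; apply Series_correct.
  - apply (ex_series_component u a Re re_le_Cmod Hu Ha).
  - apply (ex_series_component u a Im im_le_Cmod Hu Ha).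
Qed.

(** The factor 2, here and for [cint], is the cost of bounding the real and imaginary parts
    separately. *)
Lemma Cmod_csum_le (u : nat -> C) (a : nat -> R) :
  (forall k, Cmod (u k) <= a k) -> ex_series a -> Cmod (csum u) <= 2 * Series a.
Proof.
  intros Hu Ha.
  assert (H : forall p : C -> R, (forall z, Rabs (p z) <= Cmod z) ->
    Rabs (Series (fun k => p (u k))) <= Series a).
  { intros p Hp.
    assert (Hle : forall k, 0 <= Rabs (p (u k)) <= a k)
      by (intros k; split; [apply Rabs_pos|apply Rle_trans with (2 := Hu k), Hp]).
    apply Rle_trans with (Series (fun k => Rabs (p (u k)))).
    - apply Series_Rabs, (ex_series_le (V := R_CompleteNormedModule) _ a); [|exact Ha].
      intros n; unfold norm; simpl; unfold abs; simpl. rewrite Rabs_Rabsolu; apply Hle.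
    - apply Series_le; [exact Hle|exact Ha]. }
  apply Rle_trans with (1 := Cmod_le_sum _); unfold csum; simpl Re; simpl Im.
  pose proof (H Re re_le_Cmod); pose proof (H Im im_le_Cmod). lra.
Qed.

(** Linearity in the exact shape of a differentiability remainder, so that termwise bounds apply;
    [cint_remainder] does the same under the integral. The common majorant makes all the total
    [Series] genuine sums. *)
Lemma csum_remainder (u v w : nat -> C) (a : nat -> R) (h : C) : ex_series a ->
  (forall k, Cmod (u k) <= a k) -> (forall k, Cmod (v k) <= a k) -> (forall k, Cmod (w k) <= a k) ->
  (csum u - csum v - csum w * h)%C = csum (fun k => u k - v k - w k * h)%C.
Proof.
  intros Ha Hu Hv Hw.
  assert (X : forall t, (forall k, Cmod (t k) <= a k) ->
     ex_series (fun k => Re (t k)) /\ ex_series (fun k => Im (t k))).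
  { intros t Ht; split; [apply (ex_series_component t a Re re_le_Cmod Ht Ha)|
      apply (ex_series_component t a Im im_le_Cmod Ht Ha)]. }
  destruct (X u Hu) as [ur ui], (X v Hv) as [vr vi], (X w Hw) as [wr wi].
  assert (Hs : forall (p q r t : nat -> R) (c d : R), ex_series p -> ex_series q -> ex_series r -> ex_series t ->
     Series p - Series q - (Series r * c + Series t * d) = Series (fun k => p k - q k - (r k * c + t k * d))).
  { intros p q r t c d Hp Hq Hr Ht.
    rewrite <- !Series_scal_r.
    assert (ex_series (fun n => r n * c)) by now apply ex_series_scal_r.
    assert (ex_series (fun n => t n * d)) by now apply ex_series_scal_r.
    rewrite <- Series_plus, <- !Series_minus by
      (assumption || (now apply (ex_series_minus (V := R_NormedModule))) || (now apply (ex_series_plus (V := R_NormedModule)))).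
    reflexivity. }
  apply injective_projections.
  - change (Re (csum u - csum v - csum w * h)%C = Series (fun k => Re (u k - v k - w k * h)%C)).
    rewrite <- (Series_ext (fun k => Re (u k) - Re (v k) - (Re (w k) * Re h + Im (w k) * - Im h))).
    + rewrite <- Hs by assumption. unfold Cminus; rewrite !re_plus, !re_opp, re_mult.
      unfold csum, Re, Im; simpl; ring.
    + intros k. unfold Cminus; rewrite !re_plus, !re_opp, re_mult. ring.
  - change (Im (csum u - csum v - csum w * h)%C = Series (fun k => Im (u k - v k - w k * h)%C)).
    rewrite <- (Series_ext (fun k => Im (u k) - Im (v k) - (Re (w k) * Im h + Im (w k) * Re h))).
    + rewrite <- Hs by assumption. unfold Cminus; rewrite !im_plus, !im_opp, im_mult.
      unfold csum, Re, Im; simpl; ring.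
    + intros k. unfold Cminus; rewrite !im_plus, !im_opp, im_mult. ring.
Qed.

(** Termwise differentiation: the remainders are bounded by a k times |h|^2, so they add up to a
    quadratic remainder of the whole. *)
Lemma holo_at_csum (J : nat -> C -> C) (J' : nat -> C) (a : nat -> R) (z : C) (d : R) :
  0 < d -> ex_series a -> (forall k, Cmod (J' k) <= a k) ->
  (forall k h, Cmod h < d -> Cmod (J k (z + h)%C) <= a k) ->
  (forall k h, Cmod h < d -> Cmod (J k (z + h) - J k z - J' k * h)%C <= a k * Cmod h ^ 2) ->
  holo_at (fun z => csum (fun k => J k z)) z.
Proof.
  intros Hd Ha HJ' HJ HQ.
  apply (holo_at_quadratic _ z (csum J') (2 * Series a) d Hd).
  intros h Hh.
  rewrite (csum_remainder _ _ _ a).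
  - apply Rle_trans with (2 * Series (fun k => a k * Cmod h ^ 2)).
    + apply Cmod_csum_le; [intros k; now apply HQ|now apply ex_series_scal_r].
    + rewrite Series_scal_r; lra.
  - exact Ha.
  - intros k; now apply HJ.
  - intros k; replace z with (z + 0)%C by ring; apply HJ; rewrite Cmod_0; exact Hd.
  - exact HJ'.
Qed.

(** * Integrals over the unit interval *)

Definition cint (f : R -> C) : C := (RInt (fun t => Re (f t)) 0 1, RInt (fun t => Im (f t)) 0 1).

Definition ccont (f : R -> C) : Prop := forall t, 0 <= t <= 1 ->
  continuous (fun t => Re (f t)) t /\ continuous (fun t => Im (f t)) t.

Lemma ex_RInt_ccont (f : R -> C) : ccont f ->
  ex_RInt (fun t => Re (f t)) 0 1 /\ ex_RInt (fun t => Im (f t)) 0 1.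
Proof.
  intros Hf; split; apply (ex_RInt_continuous (V := R_CompleteNormedModule)); intros t Ht;
    rewrite Rmin_left, Rmax_right in Ht by lra; now apply Hf.
Qed.

Lemma Cmod_cint_le (f : R -> C) (M : R) : ccont f ->
  (forall t, 0 <= t <= 1 -> Cmod (f t) <= M) -> Cmod (cint f) <= 2 * M.
Proof.
  intros Hf HM; destruct (ex_RInt_ccont f Hf) as [H1 H2].
  assert (H : forall p : C -> R, (forall z, Rabs (p z) <= Cmod z) -> ex_RInt (fun t => p (f t)) 0 1 ->
    Rabs (RInt (fun t => p (f t)) 0 1) <= M).
  { intros p Hp He. replace M with ((1 - 0) * M) by ring.
    apply (norm_RInt_le_const (V := R_NormedModule) (fun t => p (f t)) 0 1); [lra| |].
    - intros t Ht; apply Rle_trans with (1 := Hp _); now apply HM.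
    - now apply (RInt_correct (V := R_CompleteNormedModule)). }
  apply Rle_trans with (1 := Cmod_le_sum _); unfold cint; simpl Re; simpl Im.
  pose proof (H Re re_le_Cmod H1); pose proof (H Im im_le_Cmod H2). lra.
Qed.

Lemma cint_remainder (f g k : R -> C) (h : C) : ccont f -> ccont g -> ccont k ->
  (cint f - cint g - cint k * h)%C = cint (fun t => f t - g t - k t * h)%C.
Proof.
  intros Hf Hg Hk.
  destruct (ex_RInt_ccont f Hf) as [f1 f2], (ex_RInt_ccont g Hg) as [g1 g2], (ex_RInt_ccont k Hk) as [k1 k2].
  assert (Hs : forall (p q r t : R -> R) (c d : R),
     ex_RInt p 0 1 -> ex_RInt q 0 1 -> ex_RInt r 0 1 -> ex_RInt t 0 1 ->
     RInt (fun x => p x - q x - (c * r x + d * t x)) 0 1 =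
     RInt p 0 1 - RInt q 0 1 - (c * RInt r 0 1 + d * RInt t 0 1)).
  { intros p q r t c d Hp Hq Hr Ht. apply is_RInt_unique.
    apply (is_RInt_minus (V := R_NormedModule)).
    - apply (is_RInt_minus (V := R_NormedModule)); now apply (RInt_correct (V := R_CompleteNormedModule)).
    - apply (is_RInt_plus (V := R_NormedModule)); apply (is_RInt_scal (V := R_NormedModule));
        now apply (RInt_correct (V := R_CompleteNormedModule)). }
  apply injective_projections.
  - change (Re (cint f - cint g - cint k * h)%C = RInt (fun t => Re (f t - g t - k t * h)%C) 0 1).
    rewrite <- (RInt_ext (fun t => Re (f t) - Re (g t) - (Re h * Re (k t) + - Im h * Im (k t)))).
    + rewrite Hs by assumption. unfold Cminus; rewrite !re_plus, !re_opp, re_mult.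
      unfold cint, Re, Im; simpl; ring.
    + intros t _. unfold Cminus; rewrite !re_plus, !re_opp, re_mult. simpl; ring.
  - change (Im (cint f - cint g - cint k * h)%C = RInt (fun t => Im (f t - g t - k t * h)%C) 0 1).
    rewrite <- (RInt_ext (fun t => Im (f t) - Im (g t) - (Im h * Re (k t) + Re h * Im (k t)))).
    + rewrite Hs by assumption. unfold Cminus; rewrite !im_plus, !im_opp, im_mult.
      unfold cint, Re, Im; simpl; ring.
    + intros t _. unfold Cminus; rewrite !im_plus, !im_opp, im_mult. simpl; ring.
Qed.

Lemma ccont_remainder (f g k : R -> C) (h : C) : ccont f -> ccont g -> ccont k ->
  ccont (fun t => f t - g t - k t * h)%C.
Proof.
  intros Hf Hg Hk t Ht.
  destruct (Hf t Ht) as [f1 f2], (Hg t Ht) as [g1 g2], (Hk t Ht) as [k1 k2].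
  assert (Hs : forall (p q r s : R -> R) (c d : R), continuous p t -> continuous q t ->
     continuous r t -> continuous s t ->
     continuous (fun x => p x - q x - (c * r x + d * s x)) t).
  { intros p q r s c d Hp Hq Hr Hs.
    apply (continuous_minus (V := R_NormedModule)); [now apply (continuous_minus (V := R_NormedModule))|].
    apply (continuous_plus (V := R_NormedModule)); apply (continuous_scal_r (V := R_NormedModule)); assumption. }
  split.
  - apply continuous_ext with (fun t => Re (f t) - Re (g t) - (Re h * Re (k t) + - Im h * Im (k t))).
    + intros x. unfold Cminus; rewrite !re_plus, !re_opp, re_mult. simpl; ring.
    + now apply Hs.
  - apply continuous_ext with (fun t => Im (f t) - Im (g t) - (Im h * Re (k t) + Re h * Im (k t))).
    + intros x. unfold Cminus; rewrite !im_plus, !im_opp, im_mult. simpl; ring.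
    + now apply Hs.
Qed.

Lemma ln_nonneg (x : R) : 1 <= x -> 0 <= ln x.
Proof. intros [H|H]; [left; rewrite <- ln_1; apply ln_increasing; lra|rewrite <- H, ln_1; lra]. Qed.

Lemma ln_le_compat (x y : R) : 0 < x -> x <= y -> ln x <= ln y.
Proof. intros Hx [H|H]; [left; now apply ln_increasing|rewrite H; lra]. Qed.

(** With y = ln x this trades a logarithm for a small power: ln x <= x^eta / eta. *)
Lemma le_exp_scaled (eta y : R) : 0 < eta -> y <= exp (eta * y) / eta.
Proof.
  intros He; apply Rmult_le_reg_r with eta; [exact He|].
  unfold Rdiv; rewrite Rmult_assoc, Rinv_l, Rmult_1_r by lra.
  pose proof (exp_ineq1_le (eta * y)); lra.
Qed.

(** Integral test: by the mean value theorem a term is at most the increment of the antiderivative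
    -x^(-e) / e over the preceding unit interval, and these increments telescope. *)
Lemma ex_series_zeta (e : R) : 0 < e -> ex_series (fun n => exp (- (1 + e) * ln (INR n + 1))).
Proof.
  intros He.
  set (a := fun n => exp (- (1 + e) * ln (INR n + 1))).
  set (v := fun n => exp (- e * ln (INR n + 1)) / e).
  assert (Hstep : forall n, a (S n) <= v n - v (S n)).
  { intros n; unfold a, v; rewrite S_INR. pose proof (pos_INR n). set (x := INR n + 1) in *.
    destruct (MVT_cor2 (fun x => - exp (- e * ln x) / e) (fun x => exp (- (1 + e) * ln x)) x (x + 1))
      as [c [Hc1 Hc2]]; [lra| |].
    - intros c Hc. apply is_derive_Reals. auto_derive; [unfold x in *; lra|].
      replace (- (1 + e) * ln c) with (- e * ln c + - ln c) by ring.
      rewrite exp_plus, exp_Ropp, exp_ln by (unfold x in *; lra). field. unfold x in *; lra.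
    - assert (exp (- (1 + e) * ln (x + 1)) <= exp (- (1 + e) * ln c)).
      { apply exp_le. pose proof (ln_le_compat c (x + 1)). unfold x in *; nra. }
      unfold Rdiv in *; lra. }
  assert (Hsum : forall n, sum_n a n <= 1 + v 0%nat - v n).
  { induction n as [|n IH].
    - rewrite sum_O. unfold a; simpl. rewrite Rplus_0_l, ln_1, Rmult_0_r, exp_0. lra.
    - rewrite sum_Sn; unfold plus; simpl. specialize (Hstep n); lra. }
  destruct (ex_finite_lim_seq_incr (sum_n a) (1 + v 0%nat)) as [l Hl].
  - intros n; rewrite sum_Sn; unfold plus; simpl. pose proof (exp_pos (- (1 + e) * ln (INR (S n) + 1))).
    unfold a at 3; lra.
  - intros n; apply Rle_trans with (1 := Hsum n).
    assert (0 < v n) by (apply Rdiv_lt_0_compat; [apply exp_pos|exact He]). lra.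
  - exists l; exact Hl.
Qed.

Lemma Cmod_cpow (x : R) (z : C) : Cmod (cpow x z) = exp (Re z * ln x).
Proof. now rewrite cpow_cexp, Cmod_cexp, re_scal_r. Qed.

Lemma cpow_plus (x : R) (z w : C) : cpow x (z + w)%C = (cpow x z * cpow x w)%C.
Proof. rewrite !cpow_cexp, <- cexp_plus. f_equal; ring. Qed.

Lemma cpow_remainder (x : R) (z h : C) : 1 <= x ->
  Cmod (cpow x (z + h) - cpow x z - RtoC (ln x) * cpow x z * h)%C
  <= 3 * exp ((Re z + Cmod h) * ln x) * ln x ^ 2 * Cmod h ^ 2.
Proof.
  intros Hx; pose proof (ln_nonneg x Hx).
  rewrite cpow_plus, (cpow_cexp x h).
  replace (cpow x z * cexp (h * ln x) - cpow x z - ln x * cpow x z * h)%C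
    with (cpow x z * (cexp (h * ln x) - 1 - h * ln x))%C by ring.
  rewrite Cmod_mult, Cmod_cpow.
  pose proof (cexp_remainder (h * RtoC (ln x))%C) as Hr.
  rewrite Cmod_mult, Cmod_R, Rabs_pos_eq in Hr by lra.
  replace ((Re z + Cmod h) * ln x) with (Re z * ln x + Cmod h * ln x) by ring.
  rewrite exp_plus.
  apply Rle_trans with (exp (Re z * ln x) * (3 * exp (Cmod h * ln x) * (Cmod h * ln x) ^ 2)).
  - apply Rmult_le_compat_l; [left; apply exp_pos|exact Hr].
  - right; ring.
Qed.

Lemma continuous_cpow (z : C) (c t : R) : 0 < c + t ->
  continuous (fun t => Re (cpow (c + t) z)) t /\ continuous (fun t => Im (cpow (c + t) z)) t.
Proof.
  intros Hc; unfold cpow; simpl; split; apply (ex_derive_continuous (V := R_NormedModule));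
    auto_derive; repeat split; lra.
Qed.

Definition power_integral (p : R -> R) (n : nat) (z : C) : C :=
  cint (fun t => RtoC (p t) * cpow (INR n + 1 + t) z)%C.

(** [q] is 1 for the integrand itself and a logarithm for its derivative in z. *)
Lemma ccont_power (p q : R -> R) (n : nat) (z : C) :
  (forall t, continuous p t) ->
  (forall t, 0 <= t <= 1 -> continuous q t) ->
  ccont (fun t => RtoC (p t) * (RtoC (q t) * cpow (INR n + 1 + t) z))%C.
Proof.
  intros Hp Hq t Ht; pose proof (pos_INR n).
  destruct (continuous_cpow z (INR n + 1) t) as [H1 H2]; [lra|].
  split.
  - apply continuous_ext with (fun t => p t * (q t * Re (cpow (INR n + 1 + t) z))).
    { intros; now rewrite !re_scal_l. }
    apply (continuous_mult p); [apply Hp|]. apply (continuous_mult q); [now apply Hq|exact H1].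
  - apply continuous_ext with (fun t => p t * (q t * Im (cpow (INR n + 1 + t) z))).
    { intros; now rewrite !im_scal_l. }
    apply (continuous_mult p); [apply Hp|]. apply (continuous_mult q); [now apply Hq|exact H2].
Qed.

Lemma ccont_ext (f g : R -> C) : (forall t, f t = g t) -> ccont f -> ccont g.
Proof.
  intros E Hf t Ht; destruct (Hf t Ht) as [H1 H2]; split.
  - apply continuous_ext with (2 := H1); intros; now rewrite E.
  - apply continuous_ext with (2 := H2); intros; now rewrite E.
Qed.

Theorem holo_at_power_integral_sum (p : R -> R) (z : C) : (forall t, continuous p t) ->
  Re z < -1 -> holo_at (fun z => csum (fun n => power_integral p n z)) z.
Proof.
  intros Hp Hz.
  destruct (continuous_bounded p 0 1) as [B [HB0 HB]]; [lra|auto|].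
  (* The distance of Re z to -1 is spent in four parts: one for |h| < eta, up to two for the factor
     ln^2 in the remainder, and one left over for the convergent majorant with exponent -(1 +
     eta). *)
  set (eta := (-1 - Re z) / 4). assert (Heta : 0 < eta) by (unfold eta; lra).
  assert (Hre : Re z = -1 - 4 * eta) by (unfold eta; field).
  (* K dominates the constants of three bounds at once: 1 for the terms, 1 / eta for their
     derivatives, 3 / eta^2 for the remainders. 2 B comes from the integral and from the bound on
     p. *)
  set (K := 2 * B * (1 + 1 / eta + 3 / eta ^ 2)).
  assert (He1 : 0 < 1 / eta) by (apply Rdiv_lt_0_compat; lra).
  assert (He2 : 0 < 3 / eta ^ 2) by (apply Rdiv_lt_0_compat; [lra|apply pow_lt; lra]).
  set (a := fun n => K * exp (- (1 + eta) * ln (INR n + 1))).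
  assert (HK : 0 <= K) by (unfold K; nra).
  assert (Hx : forall n t, 0 <= t <= 1 -> 1 <= INR n + 1 + t /\
     (forall c, c <= - (1 + eta) -> exp (c * ln (INR n + 1 + t)) <= exp (- (1 + eta) * ln (INR n + 1)))).
  { intros n t Ht; pose proof (pos_INR n); split; [lra|]. intros c Hc; apply exp_le.
    pose proof (ln_le_compat (INR n + 1) (INR n + 1 + t) ltac:(lra) ltac:(lra)).
    pose proof (ln_nonneg (INR n + 1) ltac:(lra)). nra. }
  assert (Hint : forall n (f : R -> C) (q : R), ccont f -> 0 <= q ->
     (forall t, 0 <= t <= 1 -> Cmod (f t) <= B * (q * exp (- (1 + eta) * ln (INR n + 1)))) ->
     Cmod (cint f) <= 2 * B * q * exp (- (1 + eta) * ln (INR n + 1))).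
  { intros n f q Hf Hq Hb. apply Rle_trans with (1 := Cmod_cint_le _ _ Hf Hb). right; ring. }
  assert (Hcont : forall n z, ccont (fun t => RtoC (p t) * cpow (INR n + 1 + t) z)%C).
  { intros n w. apply ccont_ext with (fun t => RtoC (p t) * (RtoC 1 * cpow (INR n + 1 + t) w))%C.
    - intros; ring.
    - apply (ccont_power p (fun _ => 1)); [exact Hp|intros; apply continuous_const]. }
  assert (Hcontln : forall n, ccont (fun t => RtoC (p t) * (RtoC (ln (INR n + 1 + t)) * cpow (INR n + 1 + t) z))%C).
  { intros n. apply (ccont_power p (fun t => ln (INR n + 1 + t))); [exact Hp|].
    intros t Ht; pose proof (pos_INR n). apply (ex_derive_continuous (V := R_NormedModule)).
    auto_derive; lra. }
  apply (holo_at_csum (power_integral p)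
     (fun n => cint (fun t => RtoC (p t) * (RtoC (ln (INR n + 1 + t)) * cpow (INR n + 1 + t) z))%C)
     a z eta Heta).
  - apply (ex_series_scal_l (K := R_AbsRing) (V := R_NormedModule)), ex_series_zeta, Heta.
  - intros n. apply Rle_trans with (2 * B * (1 / eta) * exp (- (1 + eta) * ln (INR n + 1))).
    + apply Hint; [apply Hcontln|lra|].
      intros t Ht; destruct (Hx n t Ht) as [X1 X2].
      rewrite !Cmod_mult, !Cmod_R, Cmod_cpow.
      apply Rmult_le_compat; [apply Rabs_pos| |now apply HB|].
      { apply Rmult_le_pos; [apply Rabs_pos|left; apply exp_pos]. }
      pose proof (ln_nonneg _ X1) as X3. rewrite Rabs_pos_eq by exact X3.
      pose proof (le_exp_scaled eta (ln (INR n + 1 + t)) Heta) as X4.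
      apply Rle_trans with (exp (eta * ln (INR n + 1 + t)) / eta * exp (Re z * ln (INR n + 1 + t))).
      { apply Rmult_le_compat_r; [left; apply exp_pos|exact X4]. }
      replace (exp (eta * ln (INR n + 1 + t)) / eta * exp (Re z * ln (INR n + 1 + t)))
        with (1 / eta * exp ((eta + Re z) * ln (INR n + 1 + t)))
        by (rewrite Rmult_plus_distr_r, exp_plus; field; lra).
      apply Rmult_le_compat_l; [lra|]. apply X2; lra.
    + unfold a, K. apply Rmult_le_compat_r; [left; apply exp_pos|]. apply Rmult_le_compat_l; lra.
  - intros n h Hh. apply Rle_trans with (2 * B * 1 * exp (- (1 + eta) * ln (INR n + 1))).
    + apply Hint; [apply Hcont|lra|].
      intros t Ht; destruct (Hx n t Ht) as [X1 X2].
      rewrite Cmod_mult, Cmod_R, Cmod_cpow.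
      apply Rmult_le_compat; [apply Rabs_pos|left; apply exp_pos|now apply HB|].
      rewrite Rmult_1_l; apply X2. rewrite re_plus.
      pose proof (re_le_Cmod h) as Hr; apply Rabs_le_between in Hr. lra.
    + unfold a, K. apply Rmult_le_compat_r; [left; apply exp_pos|]. apply Rmult_le_compat_l; lra.
  - intros n h Hh. unfold power_integral. pose proof (Cmod_ge_0 h) as Hh0.
    rewrite cint_remainder by auto.
    apply Rle_trans with (2 * B * (3 / eta ^ 2 * Cmod h ^ 2) * exp (- (1 + eta) * ln (INR n + 1))).
    + apply Hint.
      * now apply ccont_remainder.
      * apply Rmult_le_pos; [lra|apply pow2_ge_0].
      * intros t Ht; destruct (Hx n t Ht) as [X1 X2].
        set (x := INR n + 1 + t) in *.
        replace (p t * cpow x (z + h) - p t * cpow x z - p t * (ln x * cpow x z) * h)%C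
          with (RtoC (p t) * (cpow x (z + h) - cpow x z - ln x * cpow x z * h))%C by ring.
        rewrite Cmod_mult, Cmod_R.
        apply Rmult_le_compat; [apply Rabs_pos|apply Cmod_ge_0|now apply HB|].
        apply Rle_trans with (1 := cpow_remainder x z h X1).
        pose proof (ln_nonneg _ X1) as X3.
        pose proof (le_exp_scaled eta (ln x) Heta) as X4.
        assert (X5 : ln x ^ 2 <= (exp (eta * ln x) / eta) ^ 2) by (apply pow_incr; lra).
        assert (X6 : exp ((Re z + Cmod h) * ln x) <= exp ((Re z + eta) * ln x)) by (apply exp_le; nra).
        apply Rle_trans with (3 * exp ((Re z + eta) * ln x) * (exp (eta * ln x) / eta) ^ 2 * Cmod h ^ 2).
        { apply Rmult_le_compat_r; [apply pow2_ge_0|].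
          rewrite !Rmult_assoc; apply Rmult_le_compat_l; [lra|].
          apply Rmult_le_compat; [left; apply exp_pos|apply pow2_ge_0|exact X6|exact X5]. }
        replace (3 * exp ((Re z + eta) * ln x) * (exp (eta * ln x) / eta) ^ 2 * Cmod h ^ 2)
          with (3 / eta ^ 2 * Cmod h ^ 2 * exp ((Re z + eta + (eta + eta)) * ln x))
          by (rewrite (Rmult_plus_distr_r (Re z + eta)), (Rmult_plus_distr_r eta), !exp_plus; field; lra).
        apply Rmult_le_compat_l; [|apply X2; lra].
        apply Rmult_le_pos; [lra|apply pow2_ge_0].
    + unfold a, K.
      replace (2 * B * (3 / eta ^ 2 * Cmod h ^ 2) * exp (- (1 + eta) * ln (INR n + 1)))
        with (2 * B * (3 / eta ^ 2) * exp (- (1 + eta) * ln (INR n + 1)) * Cmod h ^ 2) by ring.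
      apply Rmult_le_compat_r; [apply pow2_ge_0|].
      apply Rmult_le_compat_r; [left; apply exp_pos|]. apply Rmult_le_compat_l; lra.
Qed.

(* Goals produced by Coquelicot's generic lemmas carry equality at a structure sort, which [ring]
   and [field] do not recognise. *)
Ltac eq_in_R := match goal with |- @eq _ ?a ?b => change (@eq R a b) end.

(** * The Euler-Maclaurin formula on the half line s > 1 *)

Lemma is_series_Rmult_l (c : R) (a : nat -> R) (l : R) :
  is_series a l -> is_series (fun n => c * a n) (c * l).
Proof. exact (is_series_scal (V := R_NormedModule) c a l). Qed.

Lemma is_series_Rplus (a b : nat -> R) (l m : R) :
  is_series a l -> is_series b m -> is_series (fun n => a n + b n) (l + m).
Proof. exact (is_series_plus (V := R_NormedModule) a b l m). Qed.

Lemma is_series_Rminus (a b : nat -> R) (l m : R) :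
  is_series a l -> is_series b m -> is_series (fun n => a n - b n) (l - m).
Proof. exact (is_series_minus (V := R_NormedModule) a b l m). Qed.

Lemma is_series_telescope (e : R) : 0 < e ->
  is_series (fun n => exp (- e * ln (INR n + 1)) - exp (- e * ln (INR n + 2))) 1.
Proof.
  intros He.
  assert (Hsum : forall n, 1 - exp (- e * ln (INR n + 2)) =
    sum_n (fun n => exp (- e * ln (INR n + 1)) - exp (- e * ln (INR n + 2))) n).
  { induction n as [|n IH].
    - rewrite sum_O. simpl INR. rewrite !Rplus_0_l, ln_1, Rmult_0_r, exp_0. ring.
    - rewrite sum_Sn, <- IH, S_INR. unfold plus; simpl.
      replace (INR n + 1 + 1) with (INR n + 2) by ring. ring. }
  apply (is_lim_seq_ext _ _ 1 Hsum).
  replace (Finite 1) with (Finite (1 - 0)) by (f_equal; ring).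
  apply is_lim_seq_minus'; [apply is_lim_seq_const|].
  apply (is_lim_seq_ext (fun n => exp (- (e * ln (INR n + 2))))); [intros; f_equal; ring|].
  apply is_lim_comp_seq with (f := fun y => exp (- y)) (x := p_infty).
  - apply is_lim_comp with m_infty.
    + apply is_lim_exp_m.
    + replace m_infty with (Rbar_opp p_infty) by reflexivity. apply is_lim_opp, is_lim_id.
    + exists 0; intros; discriminate.
  - exists 0%nat; intros; discriminate.
  - replace p_infty with (Rbar_mult e p_infty) at 1.
    + apply is_lim_seq_scal_l.
      apply is_lim_comp_seq with (f := ln) (x := p_infty); [apply is_lim_ln_p| |].
      * exists 0%nat; intros; discriminate.
      * apply is_lim_seq_plus with p_infty 2; [apply is_lim_seq_INR|apply is_lim_seq_const|reflexivity].
    + simpl. destruct (Rle_dec 0 e) as [H|H]; [|lra]. destruct (Rle_lt_or_eq_dec 0 e H); [reflexivity|lra].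
Qed.

(** The part over [n + 1, n + 2] of the remainder integral from 1 to infinity: the periodic
    Bernoulli function B_k({x}) / k! against x^(-s-k). *)
Definition em_term (s : R) (k n : nat) : R :=
  RInt (fun t => bern_poly k t * exp (- (s + INR k) * ln (INR n + 1 + t))) 0 1.

Lemma continuous_em_integrand (k : nat) (c e t : R) : 0 < c + t ->
  continuous (fun t => bern_poly k t * exp (e * ln (c + t))) t.
Proof.
  intros H; apply (continuous_mult (bern_poly k)); [apply continuous_bern_poly|].
  apply (ex_derive_continuous (V := R_NormedModule)); auto_derive; lra.
Qed.

(** Integration by parts: the derivative of [F] is integrated once by its end values and once
    through the product rule. *)
Lemma em_term_parts (s : R) (k n : nat) :
  em_term s k n = bern_poly (S k) 1 * exp (- (s + INR k) * ln (INR n + 2))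
    - bern_poly (S k) 0 * exp (- (s + INR k) * ln (INR n + 1))
    + (s + INR k) * em_term s (S k) n.
Proof.
  pose proof (pos_INR n) as Hn.
  set (e := - (s + INR k)). set (c := INR n + 1).
  set (F := fun t => bern_poly (S k) t * exp (e * ln (c + t))).
  set (f0 := fun t => bern_poly k t * exp (e * ln (c + t))).
  set (f1 := fun t => bern_poly (S k) t * exp (- (s + INR (S k)) * ln (c + t))).
  assert (H01 : forall t, Rmin 0 1 <= t <= Rmax 0 1 -> 0 < c + t).
  { intros t; rewrite Rmin_left, Rmax_right by lra; unfold c; lra. }
  assert (E0 : is_RInt f0 0 1 (em_term s k n)).
  { apply (RInt_correct (V := R_CompleteNormedModule)), (ex_RInt_continuous (V := R_CompleteNormedModule)).
    intros t Ht; now apply continuous_em_integrand, H01. }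
  assert (E1 : is_RInt f1 0 1 (em_term s (S k) n)).
  { apply (RInt_correct (V := R_CompleteNormedModule)), (ex_RInt_continuous (V := R_CompleteNormedModule)).
    intros t Ht; now apply continuous_em_integrand, H01. }
  assert (E2 : is_RInt (fun t => plus (f0 t) (scal e (f1 t))) 0 1 (minus (F 1) (F 0))).
  { apply (is_RInt_derive (V := R_CompleteNormedModule)).
    - intros t Ht; specialize (H01 t Ht). unfold F.
      evar_last.
      + apply (is_derive_mult (K := R_AbsRing) (bern_poly (S k))); [apply is_derive_bern_poly| |apply Rmult_comm].
        instantiate (1 := e * exp (e * ln (c + t)) / (c + t)). auto_derive; [exact H01|field; lra].
      + unfold f0, f1, plus, scal, mult; simpl; unfold mult; simpl.
        replace (- (s + match k with O => 1 | S _ => INR k + 1 end) * ln (c + t))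
          with (e * ln (c + t) + - ln (c + t)) by (unfold e; destruct k; simpl; ring).
        rewrite exp_plus, exp_Ropp, exp_ln by exact H01. field. lra.
    - intros t Ht; specialize (H01 t Ht).
      apply (continuous_plus (V := R_NormedModule)); [now apply continuous_em_integrand|].
      apply (continuous_scal_r (V := R_NormedModule)). now apply continuous_em_integrand. }
  assert (E3 : is_RInt (fun t => plus (f0 t) (scal e (f1 t))) 0 1
    (plus (em_term s k n) (scal e (em_term s (S k) n)))).
  { apply (is_RInt_plus (V := R_NormedModule)); [exact E0|]. now apply (is_RInt_scal (V := R_NormedModule)). }
  pose proof (is_RInt_unique _ _ _ _ E2) as U2. pose proof (is_RInt_unique _ _ _ _ E3) as U3.
  rewrite U2 in U3. unfold minus, plus, opp, scal in U3; simpl in U3; unfold mult in U3; simpl in U3.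
  unfold F in U3. replace (c + 1) with (INR n + 2) in U3 by (unfold c; ring).
  rewrite Rplus_0_r in U3. fold c. unfold e in *. lra.
Qed.

Lemma em_term_0 (s : R) (n : nat) : s <> 1 ->
  em_term s 0 n = / (s - 1) * (exp (- (s - 1) * ln (INR n + 1)) - exp (- (s - 1) * ln (INR n + 2))).
Proof.
  intros Hs; pose proof (pos_INR n) as Hn. apply is_RInt_unique.
  replace (/ (s - 1) * (exp (- (s - 1) * ln (INR n + 1)) - exp (- (s - 1) * ln (INR n + 2))))
    with (minus (- / (s - 1) * exp (- (s - 1) * ln (INR n + 1 + 1))) (- / (s - 1) * exp (- (s - 1) * ln (INR n + 1 + 0)))).
  2:{ unfold minus, plus, opp; simpl. rewrite Rplus_0_r. replace (INR n + 1 + 1) with (INR n + 2) by ring. ring. }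
  apply (is_RInt_derive (V := R_CompleteNormedModule) (fun t => - / (s - 1) * exp (- (s - 1) * ln (INR n + 1 + t)))).
  - intros t; rewrite Rmin_left, Rmax_right by lra; intros Ht.
    auto_derive; [lra|]. rewrite bern_poly_0_l.
    replace (- (s + INR 0) * ln (INR n + 1 + t)) with (- (s - 1) * ln (INR n + 1 + t) + - ln (INR n + 1 + t)) by (simpl; ring).
    rewrite exp_plus, exp_Ropp, exp_ln by lra. field. lra.
  - intros t; rewrite Rmin_left, Rmax_right by lra; intros Ht.
    apply continuous_em_integrand; lra.
Qed.

(** The rising factorial x (x + 1) ... (x + k - 1), which collects the factors s + k gained in
    successive integrations by parts. *)
Fixpoint rpoch (x : R) (k : nat) : R :=
  match k with O => 1 | S k' => rpoch x k' * (x + INR k') end.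

Fixpoint em_corr (x : R) (m : nat) : R :=
  match m with O => 0 | S m' => em_corr x m' + rpoch x (S m') * bern (S (S m')) end.

Lemma rpoch_pos (x : R) (k : nat) : 0 < x -> 0 < rpoch x k.
Proof.
  intros Hx; induction k as [|k IH]; simpl; [lra|].
  apply Rmult_lt_0_compat; [exact IH|]. pose proof (pos_INR k); lra.
Qed.

Lemma rpoch_neg_eq_0 (j k : nat) : (j < k)%nat -> rpoch (- INR j) k = 0.
Proof.
  induction k as [|k IH]; intros Hk; [lia|]. simpl.
  destruct (Nat.eq_dec j k) as [->|Hne]; [ring|rewrite IH by lia; ring].
Qed.

(** The zeta series enters only at the first integration by parts, where B_1(1) = 1/2 and B_1(0) =
    -1/2 differ. From then on the polynomials agree at 0 and 1, so the boundary terms telescope and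
    add one correction term each. *)
Lemma is_series_em_term (s z : R) : 1 < s ->
  is_series (fun n => exp (- s * ln (INR n + 1))) z ->
  forall m, is_series (em_term s (S m))
    ((/ (s - 1) + 1 / 2 + em_corr s m - z) / rpoch s (S m)).
Proof.
  intros Hs Hz; induction m as [|m IH].
  - pose proof (is_series_telescope s ltac:(lra)) as T1.
    pose proof (is_series_telescope (s - 1) ltac:(lra)) as T0.
    apply (is_series_ext (fun n => / s * (/ (s - 1) * (exp (- (s - 1) * ln (INR n + 1)) - exp (- (s - 1) * ln (INR n + 2)))
      + (1 / 2 * (exp (- s * ln (INR n + 1)) - exp (- s * ln (INR n + 2))) - exp (- s * ln (INR n + 1)))))).
    + intros n. rewrite <- em_term_0 by lra. rewrite (em_term_parts s 0 n).
      rewrite !bern_poly_1_l. simpl INR. rewrite !Rplus_0_r. eq_in_R; field. lra.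
    + evar_last.
      * apply is_series_Rmult_l.
        apply is_series_Rplus.
        -- apply is_series_Rmult_l; exact T0.
        -- apply is_series_Rminus; [|exact Hz].
           apply is_series_Rmult_l; exact T1.
      * simpl. eq_in_R; field. lra.
  - pose proof (pos_INR m) as Hm. assert (HS : INR (S m) = INR m + 1) by apply S_INR.
    pose proof (is_series_telescope (s + INR (S m)) ltac:(lra)) as T1.
    apply (is_series_ext (fun n => / (s + INR (S m)) * (em_term s (S m) n
       + bern (S (S m)) * (exp (- (s + INR (S m)) * ln (INR n + 1)) - exp (- (s + INR (S m)) * ln (INR n + 2)))))).
    + intros n. rewrite (em_term_parts s (S m) n).
      rewrite bern_poly_1_eq, bern_poly_0 by lia. eq_in_R; field. lra.
    + evar_last.
      * apply is_series_Rmult_l.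
        apply is_series_Rplus; [exact IH|].
        apply is_series_Rmult_l; exact T1.
      * pose proof (rpoch_pos s (S m) ltac:(lra)) as Hp.
        change (rpoch s (S (S m))) with (rpoch s (S m) * (s + INR (S m))).
        change (em_corr s (S m)) with (em_corr s m + rpoch s (S m) * bern (S (S m))).
        set (r := rpoch s (S m)) in *. set (b := bern (S (S m))). set (q := INR (S m)) in *.
        simpl. eq_in_R; field. lra.
Qed.

Fixpoint cpoch (s : C) (k : nat) : C :=
  match k with O => RtoC 1 | S k' => (cpoch s k' * (s + RtoC (INR k')))%C end.

Fixpoint em_ccorr (s : C) (m : nat) : C :=
  match m with
  | O => RtoC 0
  | S m' => (em_ccorr s m' + cpoch s (S m') * RtoC (bern (S (S m'))))%C
  end.

Lemma cpoch_RtoC (x : R) (k : nat) : cpoch (RtoC x) k = RtoC (rpoch x k).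
Proof. induction k as [|k IH]; simpl; [reflexivity|]. now rewrite IH, <- RtoC_plus, <- RtoC_mult. Qed.

Lemma em_ccorr_RtoC (x : R) (k : nat) : em_ccorr (RtoC x) k = RtoC (em_corr x k).
Proof.
  induction k as [|k IH]; [reflexivity|].
  change (em_ccorr x (S k)) with (em_ccorr x k + cpoch x (S k) * RtoC (bern (S (S k))))%C.
  now rewrite IH, cpoch_RtoC, <- RtoC_mult, <- RtoC_plus.
Qed.

Lemma holo_at_cpoch (k : nat) (z : C) : holo_at (fun s => cpoch s k) z.
Proof.
  induction k as [|k IH]; simpl; [apply holo_at_const|].
  apply holo_at_mult; [exact IH|].
  apply holo_at_plus; [apply holo_at_id|apply holo_at_const].
Qed.

Lemma holo_at_em_ccorr (k : nat) (z : C) : holo_at (fun s => em_ccorr s k) z.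
Proof.
  induction k as [|k IH]; [exact (holo_at_const (RtoC 0) z)|].
  apply (holo_at_plus (fun s => em_ccorr s k)); [exact IH|].
  apply (holo_at_mult (fun s => cpoch s (S k))); [apply holo_at_cpoch|apply holo_at_const].
Qed.

Definition em_sum (k : nat) (s : C) : C :=
  csum (fun n => power_integral (bern_poly k) n (- (s + RtoC (INR k)))%C).

(* The Euler-Maclaurin expression for zeta(s) - 1/(s-1), holomorphic on Re s > -m. *)
Definition zeta_reg (m : nat) (s : C) : C :=
  (RtoC (1 / 2) + em_ccorr s m - cpoch s (S m) * em_sum (S m) s)%C.

Lemma holo_at_zeta_reg (m : nat) (s : C) : - INR m < Re s -> holo_at (zeta_reg m) s.
Proof.
  intros Hs; unfold zeta_reg.
  apply holo_at_minus.
  - apply holo_at_plus; [apply holo_at_const|apply holo_at_em_ccorr].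
  - apply holo_at_mult; [apply holo_at_cpoch|].
    apply (holo_at_comp (fun z => csum (fun n => power_integral (bern_poly (S m)) n z))).
    + apply holo_at_power_integral_sum; [apply continuous_bern_poly|].
      rewrite re_opp, re_plus, re_RtoC, S_INR. lra.
    + apply holo_at_opp, holo_at_plus; [apply holo_at_id|apply holo_at_const].
Qed.

Lemma cpow_RtoC (x y : R) : cpow x (RtoC y) = RtoC (exp (y * ln x)).
Proof. rewrite cpow_cexp, <- RtoC_mult; apply cexp_RtoC. Qed.

Lemma power_integral_real (k n : nat) (s : R) :
  power_integral (bern_poly k) n (- (RtoC s + RtoC (INR k)))%C = RtoC (em_term s k n).
Proof.
  unfold power_integral, cint, em_term. rewrite <- RtoC_plus, <- RtoC_opp.
  unfold RtoC at 5; f_equal.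
  - apply RInt_ext; intros t _. now rewrite cpow_RtoC, <- RtoC_mult, re_RtoC.
  - rewrite (RInt_ext _ (fun _ => 0)).
    + rewrite RInt_const. unfold scal; simpl; unfold mult; simpl; ring.
    + intros t _. now rewrite cpow_RtoC, <- RtoC_mult, im_RtoC.
Qed.

(** * Zeta near 1 and at the non-positive integers *)

Section Zeta.

Variable zeta : C -> C.
Hypothesis Hzeta : riemann_zeta zeta.

Lemma zeta_real_series (s : R) : 1 < s ->
  exists z, zeta (RtoC s) = RtoC z /\ is_series (fun n => exp (- s * ln (INR n + 1))) z.
Proof.
  intros Hs. destruct Hzeta as [_ H]. specialize (H (RtoC s) ltac:(rewrite re_RtoC; exact Hs)).
  apply is_series_C_iff in H; destruct H as [H1 H2].
  assert (E : forall k, cpow (INR (k + 1)) (- RtoC s)%C = RtoC (exp (- s * ln (INR k + 1)))).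
  { intros k; rewrite <- RtoC_opp, cpow_RtoC, plus_INR. reflexivity. }
  exists (Re (zeta (RtoC s))); split.
  - assert (Hi : Im (zeta (RtoC s)) = 0).
    { rewrite <- (is_series_unique _ _ H2).
      rewrite (Series_ext _ (fun _ => 0 * 0)); [rewrite Series_scal_l; ring|].
      intros n; rewrite E, im_RtoC; ring. }
    apply injective_projections; [reflexivity|exact Hi].
  - apply is_series_ext with (2 := H1). intros n; now rewrite E, re_RtoC.
Qed.

Lemma zeta_expansion_real (m : nat) (s : R) : 1 < s ->
  zeta (RtoC s) = (/ (RtoC s - RtoC 1) + zeta_reg m (RtoC s))%C.
Proof.
  intros Hs; destruct (zeta_real_series s Hs) as [z [-> Hz]].
  unfold zeta_reg. rewrite em_ccorr_RtoC, cpoch_RtoC.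
  assert (E : em_sum (S m) (RtoC s) = RtoC ((/ (s - 1) + 1 / 2 + em_corr s m - z) / rpoch s (S m))).
  { unfold em_sum, csum. apply injective_projections; cbv [fst snd RtoC]; fold (RtoC s) (RtoC (INR (S m))).
    - apply is_series_unique. apply is_series_ext with (2 := is_series_em_term s z Hs Hz m).
      intros n; now rewrite power_integral_real, re_RtoC.
    - rewrite (Series_ext _ (fun _ => 0 * 0)); [rewrite Series_scal_l; ring|].
      intros n; rewrite power_integral_real, im_RtoC; ring. }
  rewrite E. pose proof (rpoch_pos s (S m) ltac:(lra)).
  rewrite <- RtoC_minus, <- RtoC_inv, <- RtoC_mult, <- !RtoC_plus, <- RtoC_minus, <- RtoC_plus by lra.
  f_equal. field. lra.
Qed.

(** The disc of radius m + 1 around 1 lies in Re s > -m, where [zeta_reg m] is holomorphic. The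
    factor exp (-9) is the loss in [punctured_disc_vanishing]. *)
Theorem zeta_expansion (m : nat) (s : C) :
  0 < Cmod (s - RtoC 1)%C < (INR m + 1) * exp (-9) ->
  zeta s = (/ (s - RtoC 1) + zeta_reg m s)%C.
Proof.
  intros Hs. pose proof (pos_INR m) as Hm.
  assert (H : (zeta s - (/ (s - RtoC 1) + zeta_reg m s))%C = RtoC 0).
  { apply (punctured_disc_vanishing
      (fun s => zeta s - (/ (s - RtoC 1) + zeta_reg m s))%C (RtoC 1) (INR m + 1)); [lra| | |exact Hs].
    - intros z [Hz1 Hz2].
      assert (Hne : (z - RtoC 1)%C <> RtoC 0) by now apply Cmod_gt_0.
      apply holo_at_minus.
      + apply Hzeta. intros ->. apply Hne; ring.
      + apply holo_at_plus.
        * apply (holo_at_comp Cinv); [now apply holo_at_inv|].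
          apply holo_at_minus; [apply holo_at_id|apply holo_at_const].
        * apply holo_at_zeta_reg.
          pose proof (re_le_Cmod (z - RtoC 1)%C) as Hre. unfold Cminus in Hre.
          rewrite re_plus, re_opp, re_RtoC in Hre. apply Rabs_le_between in Hre.
          unfold Cminus in Hz2. lra.
    - intros r Hr. rewrite <- RtoC_plus, (zeta_expansion_real m) by lra. ring. }
  apply Ceq_minus; exact H.
Qed.

(** m is taken so large that the shrunken disc still contains -j. The remainder sum drops out
    because its factor [cpoch] vanishes at -j. *)
Lemma zeta_negative (j : nat) : exists m, (j <= m)%nat /\
  zeta (RtoC (- INR j)) = RtoC (- / (INR j + 1) + 1 / 2 + em_corr (- INR j) m).
Proof.
  pose proof (pos_INR j) as Hj.
  destruct (INR_unbounded ((INR j + 1) * exp 9)) as [m Hm].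
  assert (He : 1 <= exp 9) by (pose proof (exp_ineq1_le 9); lra).
  assert (Hjm : (j <= m)%nat) by (apply INR_le; nra).
  exists m; split; [exact Hjm|].
  rewrite (zeta_expansion m).
  - unfold zeta_reg. rewrite em_ccorr_RtoC, cpoch_RtoC, rpoch_neg_eq_0 by lia.
    rewrite <- RtoC_minus, <- RtoC_inv by lra.
    replace (/ (- INR j - 1)) with (- / (INR j + 1)) by (field; lra).
    rewrite !RtoC_plus. ring.
  - rewrite <- RtoC_minus, Cmod_R, Rabs_left by lra. split; [lra|].
    apply Rmult_lt_compat_r with (r := exp (-9)) in Hm; [|apply exp_pos].
    rewrite Rmult_assoc, <- exp_plus in Hm. replace (9 + -9) with 0 in Hm by ring.
    rewrite exp_0 in Hm. pose proof (exp_pos (-9)). lra.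
Qed.

Lemma zeta_0 : zeta (RtoC 0) = RtoC (- (1 / 2)).
Proof.
  destruct (zeta_negative 0) as [m [_ E]]. simpl INR in E. rewrite Ropp_0 in E. rewrite E.
  assert (Hp : forall k, rpoch 0 (S k) = 0).
  { intros k; pose proof (rpoch_neg_eq_0 0 (S k) ltac:(lia)) as H.
    simpl INR in H; now rewrite Ropp_0 in H. }
  assert (Hc : forall m, em_corr 0 m = 0).
  { induction m0 as [|k IH]; [reflexivity|].
    change (em_corr 0 (S k)) with (em_corr 0 k + rpoch 0 (S k) * bern (S (S k))).
    rewrite IH, Hp; ring. }
  rewrite Hc. f_equal. field.
Qed.

Lemma rpoch_neg (j k : nat) : (k <= j)%nat ->
  rpoch (- INR j) k = (-1) ^ k * INR (fact j) / INR (fact (j - k)).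
Proof.
  induction k as [|k IH]; intros Hk.
  - rewrite Nat.sub_0_r; simpl; field; apply INR_fact_neq_0.
  - simpl rpoch. rewrite IH by lia.
    replace (j - k)%nat with (S (j - S k)) by lia. rewrite INR_fact_S.
    assert (E : INR (j - S k) = INR j - INR k - 1).
    { rewrite minus_INR by lia. rewrite S_INR; ring. }
    pose proof (pos_INR (j - S k)). rewrite E in *.
    simpl pow. field. split; [apply INR_fact_neq_0|lra].
Qed.

(** For even i the sign is -1; for odd i the Bernoulli number is zero. This removes the signs
    produced by [rpoch_neg]. *)
Lemma bern_alternate (i : nat) : (-1) ^ S i * bern (S (S i)) = - bern (S (S i)).
Proof.
  destruct (Nat.Even_or_Odd i) as [[k ->]|[k ->]].
  - rewrite pow_1_odd; ring.
  - replace (S (S (2 * k + 1))) with (2 * k + 3)%nat by lia. rewrite bern_odd; ring.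
Qed.

(** Corrections beyond order j vanish. Those that remain are, up to the factor -j!, the terms of
    B_{j+1}(1) / (j+1)! from index 2 on, while the terms of index 0 and 1 account for -1/(j+1) +
    1/2. The value B_{j+1}(1) = B_{j+1} closes the sum. *)
Lemma zeta_negative_value (j : nat) : (1 <= j)%nat ->
  zeta (RtoC (- INR j)) = RtoC (- INR (fact j) * bern (S j)).
Proof.
  intros Hj; destruct (zeta_negative j) as [m [Hm ->]]. f_equal.
  pose proof (INR_fact_neq_0 j) as Hf. pose proof (pos_INR j) as Hjp.
  assert (Hcut : em_corr (- INR j) m = em_corr (- INR j) j).
  { induction Hm as [|m Hm IH]; [reflexivity|].
    change (em_corr (- INR j) (S m)) with (em_corr (- INR j) m + rpoch (- INR j) (S m) * bern (S (S m))).
    rewrite IH, rpoch_neg_eq_0 by lia; ring. }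
  assert (Hsum : forall k, (k < j)%nat -> em_corr (- INR j) (S k) =
     - INR (fact j) * sum_f_R0 (fun i => bern (S (S i)) / INR (fact (j - S i))) k).
  { induction k as [|k IH]; intros Hk.
    - change (em_corr (- INR j) 1) with (0 + rpoch (- INR j) 1 * bern 2).
      rewrite rpoch_neg by lia. pose proof (bern_alternate 0) as Hb. simpl sum_f_R0.
      replace ((-1) ^ 1 * INR (fact j) / INR (fact (j - 1)) * bern 2)
        with (INR (fact j) / INR (fact (j - 1)) * ((-1) ^ 1 * bern 2)) by (unfold Rdiv; ring).
      rewrite Hb. unfold Rdiv; ring.
    - change (em_corr (- INR j) (S (S k))) with (em_corr (- INR j) (S k) + rpoch (- INR j) (S (S k)) * bern (S (S (S k)))).
      rewrite tech5, IH, rpoch_neg by lia. pose proof (bern_alternate (S k)) as Hb.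
      replace ((-1) ^ S (S k) * INR (fact j) / INR (fact (j - S (S k))) * bern (S (S (S k))))
        with (INR (fact j) / INR (fact (j - S (S k))) * ((-1) ^ S (S k) * bern (S (S (S k))))) by (unfold Rdiv; ring).
      rewrite Hb. unfold Rdiv; ring. }
  rewrite Hcut. destruct j as [|j]; [lia|]. rewrite Hsum by lia.
  pose proof (bern_poly_1_eq (S (S j)) ltac:(lia)) as Hone.
  unfold bern_poly in Hone. rewrite sum_f_R0_flip in Hone.
  rewrite decomp_sum in Hone by lia. simpl pred in Hone.
  rewrite decomp_sum in Hone by lia. simpl pred in Hone.
  rewrite (sum_eq _ (fun i => bern (S (S i)) / INR (fact (S j - S i)))) in Hone.
  2:{ intros i Hi. replace (S (S j) - (S (S j) - S (S i)))%nat with (S (S i)) by lia.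
      replace (S (S j) - S (S i))%nat with (S j - S i)%nat by lia. rewrite pow1, Rmult_1_r; reflexivity. }
  rewrite !pow1, Nat.sub_0_r in Hone.
  replace (S (S j) - S (S j))%nat with 0%nat in Hone by lia.
  replace (S (S j) - 1)%nat with (S j) in Hone by lia.
  replace (S (S j) - S j)%nat with 1%nat in Hone by lia.
  rewrite bern_0, bern_1, (INR_fact_S (S j)) in Hone.
  set (A := sum_f_R0 _ j) in *. set (f := INR (fact (S j))) in *. set (b := bern (S (S j))) in *.
  set (x := INR (S j)) in *.
  rewrite <- Hone. field. split; lra.
Qed.

End Zeta.

(** * The double zeta function *)

Ltac eq_in_C := match goal with |- @eq _ ?a ?b => change (@eq C a b) end.

Fixpoint csumf (f : nat -> C) (L : nat) : C :=
  match L with O => f O | S l => (csumf f l + f (S l))%C end.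

Lemma csumf_ext (f g : nat -> C) (L : nat) :
  (forall j, (j <= L)%nat -> f j = g j) -> csumf f L = csumf g L.
Proof.
  induction L as [|L IH]; intros H; simpl; [apply H; lia|].
  rewrite IH by (intros; apply H; lia). now rewrite H.
Qed.

Lemma csumf_update (f g : nat -> C) (L j0 : nat) (r : C) : (j0 <= L)%nat ->
  (forall j, j <> j0 -> f j = g j) -> f j0 = (g j0 + r)%C -> csumf f L = (csumf g L + r)%C.
Proof.
  intros Hj Hne He; induction L as [|L IH]; simpl.
  - now replace j0 with 0%nat in He by lia.
  - destruct (Nat.eq_dec j0 (S L)) as [->|Hneq].
    + rewrite He, (csumf_ext f g L) by (intros; apply Hne; lia). ring.
    + rewrite IH, (Hne (S L)) by lia. ring.
Qed.

Lemma csumf_RtoC_mult (c : nat -> R) (z : C) (L : nat) :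
  csumf (fun j => RtoC (c j) * z)%C L = (RtoC (sum_f_R0 c L) * z)%C.
Proof.
  induction L as [|L IH]; simpl; [reflexivity|]. rewrite IH, RtoC_plus; ring.
Qed.

Lemma holo_at_csumf (f : nat -> C -> C) (L : nat) (z : C) :
  (forall j, (j <= L)%nat -> holo_at (f j) z) -> holo_at (fun s => csumf (fun j => f j s) L) z.
Proof.
  induction L as [|L IH]; intros H; simpl; [apply H; lia|].
  apply (holo_at_plus (fun s => csumf (fun j => f j s) L)); [apply IH; intros; apply H; lia|].
  now apply H.
Qed.

Lemma is_series_csumf (u : nat -> nat -> C) (l : nat -> C) (L : nat) :
  (forall j, (j <= L)%nat -> @is_series C_AbsRing C_NormedModule (u j) (l j)) ->
  @is_series C_AbsRing C_NormedModule (fun k => csumf (fun j => u j k) L) (csumf l L).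
Proof.
  induction L as [|L IH]; intros H; simpl.
  - apply (is_series_ext (u 0%nat)); [reflexivity|]. now apply H.
  - apply (is_series_plus (V := C_NormedModule)); [apply IH; intros; apply H; lia|now apply H].
Qed.

Lemma is_series_C_unique (u : nat -> C) (l l' : C) :
  @is_series C_AbsRing C_NormedModule u l -> @is_series C_AbsRing C_NormedModule u l' -> l = l'.
Proof.
  intros H H'; apply is_series_C_iff in H, H'; destruct H as [H1 H2], H' as [H1' H2'].
  apply is_series_unique in H1, H2, H1', H2'.
  apply injective_projections; unfold Re, Im in *; congruence.
Qed.

Lemma Cmod_series_le (u : nat -> C) (a : nat -> R) (l : C) :
  @is_series C_AbsRing C_NormedModule u l -> (forall k, Cmod (u k) <= a k) -> ex_series a ->
  Cmod l <= 2 * Series a.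
Proof.
  intros H Hu Ha. rewrite (is_series_C_unique u l (csum u) H (is_series_csum u a Hu Ha)).
  now apply Cmod_csum_le.
Qed.

(** The form in which Abel summation is used: partial sums that differ by a boundary term tending to
    0. *)
Lemma is_series_C_perturb (u v : nat -> C) (E : nat -> C) (e : nat -> R) (l : C) :
  @is_series C_AbsRing C_NormedModule v l ->
  (forall K, sum_n (G := C_NormedModule) u K = (sum_n (G := C_NormedModule) v K + E K)%C) ->
  (forall K, Cmod (E K) <= e K) -> is_lim_seq e 0 ->
  @is_series C_AbsRing C_NormedModule u l.
Proof.
  intros Hv Hs HE He. apply is_series_C_iff in Hv; destruct Hv as [H1 H2].
  assert (Hlim : forall p : C -> R, (forall z, Rabs (p z) <= Cmod z) -> is_lim_seq (fun K => p (E K)) 0).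
  { intros p Hp. apply is_lim_seq_abs_0.
    apply is_lim_seq_le_le with (u := fun _ => 0) (w := e).
    - intros K; split; [apply Rabs_pos|]. apply Rle_trans with (2 := HE K), Hp.
    - apply is_lim_seq_const.
    - exact He. }
  apply is_series_C_iff; split.
  - change (is_lim_seq (sum_n (fun k => Re (u k))) (Re l)).
    apply (is_lim_seq_ext (fun K => sum_n (fun k => Re (v k)) K + Re (E K))).
    + intros K. rewrite <- !Re_sum_n, Hs, re_plus. reflexivity.
    + replace (Re l) with (Re l + 0) by ring.
      apply is_lim_seq_plus'; [exact H1|apply (Hlim Re re_le_Cmod)].
  - change (is_lim_seq (sum_n (fun k => Im (u k))) (Im l)).
    apply (is_lim_seq_ext (fun K => sum_n (fun k => Im (v k)) K + Im (E K))).
    + intros K. rewrite <- !Im_sum_n, Hs, im_plus. reflexivity.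
    + replace (Im l) with (Im l + 0) by ring.
      apply is_lim_seq_plus'; [exact H2|apply (Hlim Im im_le_Cmod)].
Qed.

Lemma Series_tail_lim (a : nat -> R) : ex_series a ->
  is_lim_seq (fun K => Series (fun j => a (S K + j)%nat)) 0.
Proof.
  intros Ha.
  apply (is_lim_seq_ext (fun K => Series a - sum_n a K)).
  - intros K. rewrite (Series_incr_n a (S K)) by (lia || exact Ha). rewrite sum_n_Reals. simpl pred. lra.
  - replace 0 with (Series a - Series a) by ring.
    apply is_lim_seq_minus'; [apply is_lim_seq_const|exact (Series_correct a Ha)].
Qed.

Lemma INR_pow_exp (k p : nat) : INR (k + 1) ^ p = exp (INR p * ln (INR (k + 1))).
Proof.
  assert (0 < INR (k + 1)) by (apply lt_0_INR; lia).
  rewrite <- Rpower_pow by assumption. reflexivity.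
Qed.

Section DoubleZeta.

Variable zeta : C -> C.
Hypothesis Hzeta : riemann_zeta zeta.

(** Summand j can have its pole only where s + j - 1 = 1, that is at s = 2 - j. *)
Definition zeta_comb (c : nat -> R) (L : nat) (s : C) : C :=
  csumf (fun j => RtoC (c j) * zeta (s + RtoC (INR j - 1)))%C L.

(* Abel summation turns the outer sum over m into a sum over m + j, whose coefficients are
   power sums. *)
Theorem dz_rep_zeta_comb (n L : nat) (c : nat -> R) : (L <= n + 1)%nat ->
  (forall k, sum_f_R0 (fun i => INR (i + 1) ^ n) k - INR (k + 1) ^ n
     = sum_f_R0 (fun j => c j * INR (k + 1) ^ (n + 1 - j)) L) ->
  dz_rep n (zeta_comb c L).
Proof.
  intros HL Hc s Hs.
  set (w := (s + RtoC (INR n))%C).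
  set (b := fun k : nat => cpow (INR (k + 1)) (- w)%C).
  pose proof (pos_INR n) as Hn.
  assert (Hrw : Re w = Re s + INR n) by (unfold w; now rewrite re_plus, re_RtoC).
  assert (Hb : @is_series C_AbsRing C_NormedModule b (zeta w)).
  { apply Hzeta. rewrite Hrw. lra. }
  (* T m is the inner sum over j. Indices are shifted: [b] at S m + j has the base m + j + 2 of
     [dz_term]. *)
  set (T := fun m => (zeta w - sum_n (G := C_NormedModule) b m)%C).
  assert (HT : forall m, @is_series C_AbsRing C_NormedModule (fun j => b (S m + j)%nat) (T m)).
  { intros m. apply (is_series_incr_n (V := C_NormedModule) b (S m) (T m)); [lia|].
    simpl pred. refine (eq_ind (zeta w) (fun z => @is_series C_AbsRing C_NormedModule b z) Hb _ _).
    unfold T. change (zeta w = zeta w - sum_n (G := C_NormedModule) b m + sum_n (G := C_NormedModule) b m)%C. ring. }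
  set (inner := fun m => (RtoC (INR (m + 1) ^ n) * T m)%C).
  exists inner; split.
  { intros m.
    apply (is_series_ext (V := C_NormedModule) (fun j => scal (RtoC (INR (m + 1) ^ n)) (b (S m + j)%nat))).
    - intros j. unfold dz_term, b. replace (S m + j + 1)%nat with (m + j + 2)%nat by lia. reflexivity.
    - apply (is_series_scal (V := C_NormedModule) (RtoC (INR (m + 1) ^ n)) _ (T m)), HT. }
  set (P := fun K => sum_f_R0 (fun i => INR (i + 1) ^ n) K).
  (* The inequality n_1 < n_2 is strict, so the coefficient of (k+1)^(-w) is the power sum without
     its last term. *)
  set (v := fun k => (RtoC (P k - INR (k + 1) ^ n) * b k)%C).
  set (a := fun k => exp (- (1 + (Re s - 2)) * ln (INR k + 1))).
  assert (Ha : ex_series a) by (apply ex_series_zeta; lra).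
  apply (is_series_C_perturb inner v (fun K => RtoC (P K) * T K)%C
     (fun K => 2 * Series (fun j => a (S K + j)%nat))).
  - apply (is_series_ext (V := C_NormedModule)
      (fun k => csumf (fun j => RtoC (c j) * cpow (INR (k + 1)) (- (s + RtoC (INR j - 1))))%C L)).
    + intros k. unfold v. unfold P; rewrite Hc. rewrite <- csumf_RtoC_mult.
      apply csumf_ext; intros j Hj.
      assert (E : cpow (INR (k + 1)) (- (s + RtoC (INR j - 1)))%C
         = (RtoC (INR (k + 1) ^ (n + 1 - j)) * b k)%C).
      { unfold b. rewrite INR_pow_exp, <- cpow_RtoC, <- cpow_plus. f_equal.
        unfold w. rewrite minus_INR, plus_INR by lia. rewrite !RtoC_minus, RtoC_plus. simpl INR. ring. }
      rewrite E, RtoC_mult. ring.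
    + unfold zeta_comb.
      apply (is_series_csumf (fun j k => RtoC (c j) * cpow (INR (k + 1)) (- (s + RtoC (INR j - 1))))%C).
      intros j Hj.
      apply (is_series_scal (V := C_NormedModule) (RtoC (c j)) (fun k => cpow (INR (k + 1)) (- (s + RtoC (INR j - 1)))%C)).
      apply Hzeta. rewrite re_plus, re_RtoC. pose proof (pos_INR j). lra.
  - induction K as [|K IH].
    + rewrite !sum_O. unfold inner, v. change (P 0%nat) with (INR (0 + 1) ^ n). rewrite Rminus_diag. eq_in_C; ring.
    + rewrite !sum_Sn, IH.
      assert (E : T K = (T (S K) + b (S K))%C).
      { unfold T. rewrite sum_Sn. change (plus (sum_n (G := C_NormedModule) b K) (b (S K)))
          with (sum_n (G := C_NormedModule) b K + b (S K))%C. ring. }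
      change (plus (sum_n (G := C_NormedModule) v K + RtoC (P K) * T K)%C (inner (S K)))
        with (sum_n (G := C_NormedModule) v K + RtoC (P K) * T K + inner (S K))%C.
      change (plus (sum_n (G := C_NormedModule) v K) (v (S K)))
        with (sum_n (G := C_NormedModule) v K + v (S K))%C.
      change (v (S K)) with (RtoC (P (S K) - INR (S K + 1) ^ n) * b (S K))%C.
      unfold inner. rewrite E.
      assert (EP : P (S K) = P K + INR (S K + 1) ^ n) by reflexivity.
      rewrite EP. replace (P K + INR (S K + 1) ^ n - INR (S K + 1) ^ n) with (P K) by ring.
      rewrite RtoC_plus. eq_in_C; ring.
  - intros K.
    apply (Cmod_series_le (fun j => RtoC (P K) * b (S K + j)%nat)%C).
    + apply (is_series_scal (V := C_NormedModule) (RtoC (P K)) (fun j => b (S K + j)%nat) (T K)), HT.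
    + intros j. rewrite Cmod_mult, Cmod_R. unfold b. rewrite Cmod_cpow, re_opp, Hrw.
      (* The growing factor P K is moved inside the tail T K, where it costs n + 1 powers of the
         base. What remains is a tail of the sum of k^(1 - Re s), which tends to 0 since Re s >
         2. *)
      assert (HP : 0 <= P K <= INR (S K + j + 1) ^ (n + 1)).
      { assert (Hbase : forall k, 0 <= P k <= INR (k + 1) * INR (k + 1) ^ n).
        { induction k as [|k IH]; [unfold P; simpl; rewrite pow1; lra|].
          assert (EP : P (S k) = P k + INR (S k + 1) ^ n) by reflexivity. rewrite EP.
          pose proof (pos_INR (k + 1)).
          assert (INR (k + 1) ^ n <= INR (S k + 1) ^ n) by (apply pow_incr; split; [lra|apply le_INR; lia]).
          pose proof (pow_le (INR (k + 1)) n ltac:(lra)).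
          set (X := INR (S k + 1) ^ n) in *. set (Y := INR (k + 1) ^ n) in *.
          replace (INR (S k + 1)) with (INR (k + 1) + 1) by (rewrite <- S_INR; f_equal).
          assert (INR (k + 1) * Y <= INR (k + 1) * X) by (apply Rmult_le_compat_l; lra).
          lra. }
        destruct (Hbase K) as [B1 B2]; split; [exact B1|].
        apply Rle_trans with (1 := B2). rewrite pow_add, pow_1, Rmult_comm.
        pose proof (pos_INR (K + 1)).
        apply Rmult_le_compat; [apply pow_le; lra|lra| |].
        - apply pow_incr; split; [lra|apply le_INR; lia].
        - apply le_INR; lia. }
      rewrite Rabs_pos_eq by apply HP.
      apply Rle_trans with (INR (S K + j + 1) ^ (n + 1) * exp (- (Re s + INR n) * ln (INR (S K + j + 1)))).
      * apply Rmult_le_compat_r; [left; apply exp_pos|apply HP].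
      * rewrite INR_pow_exp, <- exp_plus. unfold a. right; f_equal.
        rewrite !plus_INR. simpl (INR 1). ring.
    + apply (ex_series_incr_n a (S K)); exact Ha.
  - replace 0 with (2 * 0) by ring.
    apply (is_lim_seq_scal_l _ 2 0), Series_tail_lim, Ha.
Qed.

(** Restricting to nonzero coefficients is what lets the vanishing odd Bernoulli numbers remove the
    candidate poles at -1, -3, ... *)
Lemma zeta_comb_holo (c : nat -> R) (L : nat) (s : C) :
  (forall j, (j <= L)%nat -> c j <> 0 -> s <> RtoC (2 - INR j)) -> holo_at (zeta_comb c L) s.
Proof.
  intros H. unfold zeta_comb.
  apply (holo_at_csumf (fun j s => RtoC (c j) * zeta (s + RtoC (INR j - 1)))%C).
  intros j Hj. destruct (Req_dec (c j) 0) as [E|E].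
  - apply holo_at_ext with (fun _ => RtoC 0); [|apply holo_at_const]. intros y; rewrite E; ring.
  - apply holo_at_mult; [apply holo_at_const|]. apply holo_at_shift.
    apply Hzeta. intros E2. apply (H j Hj E).
    replace s with (s + RtoC (INR j - 1) - RtoC (INR j - 1))%C by ring.
    rewrite E2, <- RtoC_minus. f_equal; ring.
Qed.

Lemma zeta_comb_pole (c : nat -> R) (L j0 : nat) : (j0 <= L)%nat -> c j0 <> 0 ->
  pole_res (zeta_comb c L) (RtoC (2 - INR j0)) (RtoC (c j0)).
Proof.
  intros Hj0 Hc0. split; [intros E; apply Hc0; now apply RtoC_inj in E|].
  pose proof (exp_pos (-9)) as He0.
  assert (He1 : exp (-9) < 1) by (rewrite <- exp_0; apply exp_increasing; lra).
  (* Within this radius the expansion of order m = 0 is valid, and being less than 1 it excludes the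
     poles of the other summands. The regular part g has [zeta_reg 0] in place of zeta in summand j0
     only. *)
  exists (exp (-9)); split; [exact He0|].
  exists (fun z => csumf (fun j => RtoC (c j) *
    (if Nat.eq_dec j j0 then zeta_reg 0 else zeta) (z + RtoC (INR j - 1)))%C L).
  assert (Hsh : forall z j, (z + RtoC (INR j - 1) - RtoC 1 = z - RtoC (2 - INR j))%C)
    by (intros z j; rewrite !RtoC_minus; ring).
  split.
  - intros z Hz.
    apply (holo_at_csumf (fun j z => RtoC (c j) *
      (if Nat.eq_dec j j0 then zeta_reg 0 else zeta) (z + RtoC (INR j - 1)))%C).
    intros j Hj. apply holo_at_mult; [apply holo_at_const|]. apply holo_at_shift.
    destruct (Nat.eq_dec j j0) as [->|Hne].
    + apply holo_at_zeta_reg. simpl (INR 0).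
      pose proof (re_le_Cmod (z - RtoC (2 - INR j0))%C) as Hr. apply Rabs_le_between in Hr.
      unfold Cminus in *. rewrite re_plus, re_opp, !re_RtoC in Hr. rewrite re_plus, re_RtoC. lra.
    + apply Hzeta. intros E.
      assert (Ez : (z - RtoC (2 - INR j0))%C = RtoC (INR j0 - INR j)).
      { replace z with (z + RtoC (INR j - 1) - RtoC (INR j - 1))%C by ring.
        rewrite E, <- !RtoC_minus. f_equal; ring. }
      rewrite Ez, Cmod_R in Hz.
      assert (1 <= Rabs (INR j0 - INR j)); [|lra].
      destruct (Nat.lt_trichotomy j j0) as [Hlt|[Heq|Hlt]]; [|lia|];
        apply le_INR in Hlt; rewrite S_INR in Hlt; unfold Rabs; destruct Rcase_abs; lra.
  - intros z Hz. unfold zeta_comb.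
    apply csumf_update with j0; [exact Hj0| |].
    + intros j Hj. destruct (Nat.eq_dec j j0); [contradiction|reflexivity].
    + destruct (Nat.eq_dec j0 j0) as [_|]; [|contradiction].
      assert (Hne : (z - RtoC (2 - INR j0))%C <> RtoC 0) by (apply Cmod_gt_0; lra).
      rewrite (zeta_expansion zeta Hzeta 0), Hsh.
      * unfold Cdiv. ring.
      * rewrite Hsh. simpl INR. lra.
Qed.

End DoubleZeta.

(** * Faulhaber coefficients, residues and the final assembly *)

(** For n >= 1 the term 0^n is zero, so the sum may start at 0. The constant term of the Bernoulli
    polynomial cancels against [bern (S n)], which is why the right side stops at j = n. *)
Lemma faulhaber_coef (n k : nat) : (1 <= n)%nat ->
  sum_f_R0 (fun i => INR (i + 1) ^ n) k - INR (k + 1) ^ n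
  = sum_f_R0 (fun j => INR (fact n) * bern j / INR (fact (n + 1 - j)) * INR (k + 1) ^ (n + 1 - j)) n.
Proof.
  intros Hn.
  assert (E : sum_f_R0 (fun i => INR (i + 1) ^ n) k - INR (k + 1) ^ n = sum_f_R0 (fun m => INR m ^ n) k).
  { pose proof (decomp_sum (fun m => INR m ^ n) (S k) ltac:(lia)) as H. simpl pred in H.
    rewrite tech5 in H. simpl (INR 0) in H. rewrite (pow_i n) in H by lia.
    rewrite (sum_eq (fun i => INR (i + 1) ^ n) (fun i => INR (S i) ^ n))
      by (intros; now rewrite Nat.add_1_r).
    rewrite Nat.add_1_r. lra. }
  rewrite E, faulhaber. unfold bern_poly.
  rewrite sum_f_R0_flip, tech5. replace (S n - S n)%nat with 0%nat by lia. rewrite Nat.sub_0_r.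
  simpl (fact 0). simpl pow. simpl (INR 1).
  replace (INR (k + 1)) with (INR k + 1) by (rewrite plus_INR; reflexivity).
  rewrite (sum_eq (fun i => bern (S n - (S n - i)) * (INR k + 1) ^ (S n - i) / INR (fact (S n - i)))
    (fun j => bern j * (INR k + 1) ^ (n + 1 - j) / INR (fact (n + 1 - j)))).
  2:{ intros i Hi. replace (S n - (S n - i))%nat with i by lia. now replace (S n - i)%nat with (n + 1 - i)%nat by lia. }
  rewrite (sum_eq (fun j => INR (fact n) * bern j / INR (fact (n + 1 - j)) * (INR k + 1) ^ (n + 1 - j))
     (fun j => bern j * (INR k + 1) ^ (n + 1 - j) / INR (fact (n + 1 - j)) * INR (fact n)))
    by (intros; unfold Rdiv; ring).
  rewrite <- scal_sum. field.
Qed.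

(** The upper argument 2k - n of the binomial coefficient is negative, so the falling product is a
    rising one up to sign. *)
Lemma falling_neg (r b : nat) :
  falling (- Z.of_nat (S r)) b = (-1) ^ b * INR (fact (r + b)) / INR (fact r).
Proof.
  induction b as [|b IH].
  - rewrite Nat.add_0_r; simpl; field; apply INR_fact_neq_0.
  - change (falling (- Z.of_nat (S r)) (S b))
      with (falling (- Z.of_nat (S r)) b * (IZR (- Z.of_nat (S r)) - INR b)).
    rewrite IH, opp_IZR, <- INR_IZR_INZ, Nat.add_succ_r, INR_fact_S, S_INR, plus_INR.
    simpl pow. unfold Rdiv; ring.
Qed.

(** The binomial coefficient is -n! / ((n-2k-1)! (2k+1)!). Its sign and its (2k+1)! cancel against
    those in the value of zeta at -2k-1. *)
Lemma gbinom_residue (n k : nat) : (k < Nat.div2 n)%nat ->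
  gbinom (Z.of_nat (2 * k) - Z.of_nat n) (2 * k + 1) * (- INR (fact (2 * k + 1)) * bern (2 * k + 2))
  = INR (fact n) * bern (2 * k + 2) / INR (fact (n + 1 - (2 * k + 2))).
Proof.
  intros Hk. assert (Hn : (2 * k + 2 <= n)%nat).
  { destruct (Nat.Even_or_Odd n) as [[q ->]|[q ->]].
    - rewrite Nat.div2_double in Hk; lia.
    - replace (2 * q + 1)%nat with (S (2 * q)) in * by lia. rewrite Nat.div2_succ_double in Hk; lia. }
  unfold gbinom.
  replace (Z.of_nat (2 * k) - Z.of_nat n)%Z with (- Z.of_nat (S (n - 2 * k - 1)))%Z by lia.
  rewrite falling_neg. replace (n - 2 * k - 1 + (2 * k + 1))%nat with n by lia.
  replace (n + 1 - (2 * k + 2))%nat with (n - 2 * k - 1)%nat by lia.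
  replace ((-1) ^ (2 * k + 1)) with (-1) by (rewrite Nat.add_1_r, pow_1_odd; reflexivity).
  field. split; apply INR_fact_neq_0.
Qed.

Definition dz_coef (n j : nat) : R := INR (fact n) * bern j / INR (fact (n + 1 - j)).

Lemma dz_coef_0 (n : nat) : dz_coef n 0 = 1 / INR (n + 1).
Proof.
  unfold dz_coef; rewrite bern_0, Nat.sub_0_r, Nat.add_1_r, INR_fact_S, S_INR.
  pose proof (pos_INR n). field. split; [lra|apply INR_fact_neq_0].
Qed.

Lemma dz_coef_1 (n : nat) : dz_coef n 1 = - (1 / 2).
Proof.
  unfold dz_coef; rewrite bern_1, Nat.add_sub. field. apply INR_fact_neq_0.
Qed.

Lemma dz_coef_odd (n k : nat) : dz_coef n (2 * k + 3) = 0.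
Proof. unfold dz_coef; rewrite bern_odd; unfold Rdiv; ring. Qed.

Lemma dz_coef_even_neq_0 (n k : nat) : dz_coef n (2 * k + 2) <> 0.
Proof.
  unfold dz_coef, Rdiv. apply Rmult_integral_contrapositive_currified.
  - apply Rmult_integral_contrapositive_currified; [apply INR_fact_neq_0|apply bern_even_neq_0].
  - apply Rinv_neq_0_compat, INR_fact_neq_0.
Qed.

Lemma INR_even_pole (k : nat) : 2 - INR (2 * k + 2) = - INR (2 * k).
Proof. rewrite plus_INR; simpl (INR 2); ring. Qed.

Theorem theorem4p1 :
  forall zeta : C -> C, riemann_zeta zeta ->
  (* n = 0 : zeta(0, s) *)
  (exists F : C -> C, dz_rep 0 F /\
     (forall s : C, s <> RtoC 2 -> s <> RtoC 1 -> holo_at F s) /\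
     pole_res F (RtoC 2) (RtoC 1) /\
     pole_res F (RtoC 1) (Cmult (RtoC 2) (zeta (RtoC 0)))) /\
  (* n = 1 : zeta(-1, s+1) *)
  (exists F : C -> C, dz_rep 1 F /\
     (forall s : C, s <> RtoC 2 -> s <> RtoC 1 -> holo_at F s) /\
     pole_res F (RtoC 2) (RtoC (1 / 2)) /\
     pole_res F (RtoC 1) (zeta (RtoC 0))) /\
  (* n >= 2 : zeta(-n, s+n) *)
  (forall n : nat, (2 <= n)%nat ->
   exists F : C -> C, dz_rep n F /\
     (forall s : C, s <> RtoC 2 -> s <> RtoC 1 ->
        (forall k : nat, (k < Nat.div2 n)%nat -> s <> RtoC (- INR (2 * k))) ->
        holo_at F s) /\
     pole_res F (RtoC 2) (RtoC (1 / INR (n + 1))) /\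
     pole_res F (RtoC 1) (zeta (RtoC 0)) /\
     zeta (RtoC 0) = RtoC (- (1 / 2)) /\
     (forall k : nat, (k < Nat.div2 n)%nat ->
        pole_res F (RtoC (- INR (2 * k)))
          (Cmult (RtoC (gbinom (Z.of_nat (2 * k) - Z.of_nat n)%Z (2 * k + 1)))
                 (zeta (RtoC (- INR (2 * k + 1))))))).
Proof.
  intros zeta Hzeta.
  pose proof (zeta_0 zeta Hzeta) as Hz0.
  assert (P2 : RtoC (2 - INR 0) = RtoC 2) by (f_equal; simpl; ring).
  assert (P1 : RtoC (2 - INR 1) = RtoC 1) by (f_equal; simpl; ring).
  assert (Hpole : forall c L j a r, (j <= L)%nat -> c j <> 0 -> RtoC (2 - INR j) = a -> RtoC (c j) = r ->
     pole_res (zeta_comb zeta c L) a r).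
  { intros c L j a r Hj Hc <- <-. now apply zeta_comb_pole. }
  assert (Hn0 : forall n, 1 / INR (n + 1) <> 0).
  { intros n; apply Rgt_not_eq, Rdiv_lt_0_compat; [lra|apply lt_0_INR; lia]. }
  split; [|split].
  (* For n = 0 there are k = (k+1) - 1 integers m with 1 <= m < k + 1, so F(s) = zeta(s-1) -
     zeta(s). The residue -1 at s = 1 is 2 zeta(0), twice the value for n >= 1. *)
  - set (c := fun j => match j with O => 1 | _ => -1 end).
    exists (zeta_comb zeta c 1); split; [|split; [|split]].
    + apply (dz_rep_zeta_comb zeta Hzeta); [lia|].
      intros k. rewrite (sum_eq (fun i => INR (i + 1) ^ 0) (fun _ => 1)) by reflexivity.
      rewrite sum_cte, S_INR, plus_INR. simpl. ring.
    + intros s H2 H1; apply (zeta_comb_holo zeta Hzeta); intros j Hj _.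
      destruct j as [|[|j]]; [rewrite P2; exact H2|rewrite P1; exact H1|lia].
    + apply (Hpole c 1%nat 0%nat); [lia|simpl; lra|exact P2|reflexivity].
    + apply (Hpole c 1%nat 1%nat); [lia|simpl; lra|exact P1|].
      rewrite Hz0, <- RtoC_mult. f_equal; simpl; field.
  - exists (zeta_comb zeta (dz_coef 1) 1); split; [|split; [|split]].
    + apply (dz_rep_zeta_comb zeta Hzeta); [lia|]. intros k; apply faulhaber_coef; lia.
    + intros s H2 H1; apply (zeta_comb_holo zeta Hzeta); intros j Hj _.
      destruct j as [|[|j]]; [rewrite P2; exact H2|rewrite P1; exact H1|lia].
    + apply (Hpole _ 1%nat 0%nat); [lia|rewrite dz_coef_0; apply Hn0|exact P2|].
      rewrite dz_coef_0. simpl. f_equal.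
    + apply (Hpole _ 1%nat 1%nat); [lia|rewrite dz_coef_1; lra|exact P1|].
      rewrite dz_coef_1; now symmetry.
  - intros n Hn.
    assert (Hk : forall k, (k < Nat.div2 n)%nat <-> (2 * k + 2 <= n)%nat).
    { intros k; destruct (Nat.Even_or_Odd n) as [[q ->]|[q ->]].
      - rewrite Nat.div2_double; lia.
      - replace (2 * q + 1)%nat with (S (2 * q)) in * by lia. rewrite Nat.div2_succ_double; lia. }
    exists (zeta_comb zeta (dz_coef n) n); split; [|split; [|split; [|split; [|split]]]].
    + apply (dz_rep_zeta_comb zeta Hzeta); [lia|]. intros k; apply faulhaber_coef; lia.
    + intros s H2 H1 Hs; apply (zeta_comb_holo zeta Hzeta); intros j Hj Hc.
      destruct j as [|[|j]]; [rewrite P2; exact H2|rewrite P1; exact H1|].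
      (* Even indices 2k + 2 give the excluded points -2k; odd indices from 3 on have coefficient
         0. *)
      destruct (Nat.Even_or_Odd j) as [[k ->]|[k ->]].
      * replace (S (S (2 * k))) with (2 * k + 2)%nat by lia. rewrite INR_even_pole.
        apply Hs, Hk; lia.
      * exfalso; apply Hc. replace (S (S (2 * k + 1))) with (2 * k + 3)%nat by lia. apply dz_coef_odd.
    + apply (Hpole _ n 0%nat); [lia|rewrite dz_coef_0; apply Hn0|exact P2|].
      now rewrite dz_coef_0.
    + apply (Hpole _ n 1%nat); [lia|rewrite dz_coef_1; lra|exact P1|].
      rewrite dz_coef_1; now symmetry.
    + exact Hz0.
    + intros k Hlt.
      apply (Hpole _ n (2 * k + 2)%nat); [now apply Hk|apply dz_coef_even_neq_0|now rewrite INR_even_pole|].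
      rewrite (zeta_negative_value zeta Hzeta) by lia.
      rewrite <- RtoC_mult. f_equal.
      replace (S (2 * k + 1)) with (2 * k + 2)%nat by lia.
      symmetry; now apply gbinom_residue.
Qed.
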